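(* Let $I=[0,1]$ or $I=[0,\infty)$ and let $\varphi$ be an Orlicz function (with $Ces_\varphi(I)\neq\{0\}$). In the case when $\varphi(b_\varphi)=\infty$, suppose that there is $p>1$ such that the function $\varphi^{1/p}$ is equivalent to a convex function for large arguments if $I=[0,1]$, or for all arguments if $I=[0,\infty)$. (No such assumption is made when $\varphi(b_\varphi)<\infty$.) If $\varphi\notin\Delta_2$, then $Ces_\varphi(I)$ contains an order isomorphically isometric copy of $l^\infty$.
   Context: $L^0(I)$ is the space of (classes of a.e. equal) real-valued Lebesgue measurable functions on $I$. An Orlicz function is a function $\varphi:[0,\infty)\to[0,\infty]$ that is convex, satisfies $\varphi(0)=0$, is neither identically $0$ nor identically $\infty$ on $(0,\infty)$, and is left continuous on $(0,\infty)$, i.e. $\lim_{u\to b_\varphi^-}\varphi(u)=\varphi(b_\varphi)$ if $b_\varphi<\infty$, where $b_\varphi=\sup\{u>0:\varphi(u)<\infty\}$. Put $a_\varphi=\sup\{u\ge0:\varphi(u)=0\}$. It is assumed throughout that if $b_\varphi<\infty$ then $a_\varphi<b_\varphi$. If $b_\varphi=\infty$, then $\varphi(b_\varphi)$ means $\lim_{u\to\infty}\varphi(u)=\infty$, so the case $\varphi(b_\varphi)=\infty$ includes $b_\varphi=\infty$. When $\varphi(b_\varphi)=\infty$: $\varphi^{1/p}$ is equivalent to a convex function for large arguments if there are constants $A,B>0$, $u_0\in(0,b_\varphi)$ with $\varphi(u_0)>0$, and a convex function $\gamma$ such that $A\gamma(u)\le\varphi(u)^{1/p}\le B\gamma(u)$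 for all $u\in[u_0,b_\varphi)$; it is equivalent to a convex function for all arguments if there are $A,B>0$ and a convex function $\gamma$ such that these inequalities hold for all $u\in[0,b_\varphi)$. $\varphi\in\Delta_2$ means: if $I=[0,1]$, that $\varphi\in\Delta_2(\infty)$, i.e. there are $K>0$ and $u_0>0$ with $\varphi(u_0)<\infty$ and $\varphi(2u)\le K\varphi(u)$ for all $u\ge u_0$; if $I=[0,\infty)$, that $\varphi\in\Delta_2(\mathbb R_+)$, i.e. there is $K>0$ with $\varphi(2u)\le K\varphi(u)$ for all $u\ge0$. For $f\in L^0(I)$: $I_\varphi(f)=\int_I\varphi(|f(t)|)\,dt$; the Cesàro operator is $Cf(x)=\frac1x\int_0^xf(t)\,dt$ for $0<x\in I$; $\rho_\varphi(f)=I_\varphi(C|f|)$. The Cesàro–Orlicz space is $Ces_\varphi(I)=\{f\in L^0(I):\rho_\varphi(f/\lambda)<\infty\text{ for some }\lambda>0\}$ with norm $\|f\|_{Ces(\varphi)}=\inf\{\lambda>0:\rho_\varphi(f/\lambda)\le1\}$ and the a.e. pointwise order. A Banach function space $E$ contains an order isomorphically isometric copy of $l^\infty$ if there is a linear isometry $T:l^\infty\to E$ (into) such that $x\ge0\iff Tx\ge0$. *)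

(* Defs.v *)
From HB Require Import structures.
From mathcomp Require Import all_boot all_order all_algebra.
From mathcomp Require Import all_classical all_reals all_analysis.

Set Implicit Arguments.
Unset Strict Implicit.
Unset Printing Implicit Defensive.
Import Order.TTheory GRing.Theory Num.Theory.
Import numFieldNormedType.Exports.

Local Open Scope classical_set_scope.
Local Open Scope ring_scope.
Local Open Scope ereal_scope.

(* The real line with the sigma-algebra of Lebesgue (not only Borel)
   measurable sets; it is convertible to R. *)
Notation lebesgueTypeR R :=
  (caratheodory_type ((wlength (@idfun R))^*)%mu).

Notation leb_mu := (@completed_lebesgue_measure _).

Inductive base_interval := unit_interval | half_line.

Definition base_set {R : realType} (I : base_interval) : set R :=
  match I with
  | unit_interval => `[0%R, 1%R]
  | half_line => `[0%R, +oo[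
  end.

Section orlicz.
Context {R : realType}.
Implicit Types (phi : R -> \bar R).

(* A function [0, oo) -> [0, oo] is represented by phi : R -> \bar R; its
   values at negative arguments are never used. *)
Record orlicz_function phi : Prop := {
  orlicz_ge0 : forall u, (0 <= u)%R -> 0 <= phi u ;
  orlicz_convex : forall u v t : R, (0 <= u)%R -> (0 <= v)%R ->
    (0 <= t <= 1)%R ->
    phi (t * u + (1 - t) * v)%R <= t%:E * phi u + (1 - t)%:E * phi v ;
  orlicz_0 : phi 0%R = 0 ;
  orlicz_not_identically_0 : exists2 u, (0 < u)%R & phi u != 0 ;
  orlicz_not_identically_oo : exists2 u, (0 < u)%R & phi u != +oo ;
  orlicz_left_continuous : forall u, (0 < u)%R ->
    phi x @[x --> u^'-] --> phi u
}.

Definition orlicz_a phi : \bar R :=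
  ereal_sup (EFin @` [set u | (0 <= u)%R /\ phi u = 0]).

Definition orlicz_b phi : \bar R :=
  ereal_sup (EFin @` [set u | (0 < u)%R /\ phi u < +oo]).

Definition orlicz_at_b phi : \bar R :=
  if orlicz_b phi is b%:E then phi b else lim (phi u @[u --> +oo%R]).

Definition Delta2_infty phi : Prop :=
  exists K u0 : R, [/\ (0 < K)%R, (0 < u0)%R, phi u0 < +oo &
    forall u, (u0 <= u)%R -> phi (2 * u)%R <= K%:E * phi u].

Definition Delta2_Rplus phi : Prop :=
  exists2 K : R, (0 < K)%R &
    forall u, (0 <= u)%R -> phi (2 * u)%R <= K%:E * phi u.

Definition Delta2 (I : base_interval) phi : Prop :=
  match I with
  | unit_interval => Delta2_infty phi
  | half_line => Delta2_Rplus phi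
  end.

(* gamma is only required to be real-valued and convex on the set D where the
   inequalities are asserted: when orlicz_b phi is finite and phi tends to +oo
   there, no gamma finite and convex on all of [0, +oo[ could exist. *)
Definition root_equiv_convex_on (D : set R) phi (p : R) : Prop :=
  exists (A B : R) (gamma : R -> R),
    [/\ (0 < A)%R, (0 < B)%R, convex_function (D : set R^o) gamma &
      forall u, D u ->
        (A * gamma u)%:E <= poweR (phi u) p^-1 <= (B * gamma u)%:E].

Definition root_equiv_convex_large phi (p : R) : Prop :=
  exists u0 : R, [/\ (0 < u0)%R, u0%:E < orlicz_b phi, 0 < phi u0 &
    root_equiv_convex_on
      [set u | (u0 <= u)%R /\ u%:E < orlicz_b phi] phi p].

Definition root_equiv_convex_all phi (p : R) : Prop :=
  root_equiv_convex_on [set u | (0 <= u)%R /\ u%:E < orlicz_b phi] phi p.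

Definition root_equiv_convex (I : base_interval) phi (p : R) : Prop :=
  match I with
  | unit_interval => root_equiv_convex_large phi p
  | half_line => root_equiv_convex_all phi p
  end.

(* C|f| may take the value +oo, where phi is given its limit +oo at infinity;
   the -oo branch is never reached on absolute values. *)
Definition orlicz_ext phi (y : \bar R) : \bar R :=
  if y is u%:E then phi u else +oo.

Definition orlicz_modular (I : base_interval) phi (g : R -> \bar R) : \bar R :=
  \int[leb_mu]_(t in (base_set I : set (lebesgueTypeR R)))
    orlicz_ext phi `|g t|.

Definition cesaro_op (f : R -> \bar R) (x : R) : \bar R :=
  (x^-1)%:E * \int[leb_mu]_(t in (`[0%R, x] : set (lebesgueTypeR R))) f t.

Definition cesaro_modular (I : base_interval) phi (f : R -> R) : \bar R :=
  orlicz_modular I phi (cesaro_op (fun t => `|f t|%:E)).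

(* Elements of L^0(I) are represented by Lebesgue measurable functions;
   equality of classes is stated as equality almost everywhere on I. *)
Definition L0 (I : base_interval) : set (R -> R) :=
  [set f | measurable_fun (base_set I : set (lebesgueTypeR R)) f].

Definition Ces (I : base_interval) phi : set (R -> R) :=
  [set f | L0 I f /\ exists2 lambda : R, (0 < lambda)%R &
     cesaro_modular I phi (fun t => f t / lambda)%R < +oo].

(* Valued in \bar R so that the infimum of the empty set is +oo, not 0. *)
Definition Ces_norm (I : base_interval) phi (f : R -> R) : \bar R :=
  ereal_inf (EFin @` [set lambda | (0 < lambda)%R /\
    cesaro_modular I phi (fun t => f t / lambda)%R <= 1]).

Definition eq_ae (I : base_interval) (f g : R -> R) : Prop :=
  ae_eq leb_mu (base_set I : set (lebesgueTypeR R)) f g.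

Definition ge0_ae (I : base_interval) (f : R -> R) : Prop :=
  {ae leb_mu, forall t : lebesgueTypeR R, base_set I t -> (0 <= f t)%R}.

Definition linfty : set (nat -> R) := bounded_fun.

Definition linfty_norm (x : nat -> R) : R := sup (range (fun n => `|x n|%R)).

(* For a normed space (E, N) of classes of functions on I.  T is a total
   function, of which only the restriction to l^infty matters. *)
Definition contains_order_isometric_copy_of_linfty (I : base_interval)
    (E : set (R -> R)) (N : (R -> R) -> \bar R) : Prop :=
  exists T : (nat -> R) -> (R -> R),
  [/\ forall x, linfty x -> E (T x),
      forall (a : R) x y, linfty x -> linfty y ->
        eq_ae I (T (fun n => a * x n + y n)%R)
                (fun t => a * T x t + T y t)%R,
      forall x, linfty x -> N (T x) = (linfty_norm x)%:E &
      forall x, linfty x -> (forall n, (0 <= x n)%R) <-> ge0_ae I (T x)].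

End orlicz.

(* Main.v *)
Require Import Defs.
From HB Require Import structures.
From mathcomp Require Import all_boot all_order all_algebra.
From mathcomp Require Import all_classical all_reals all_analysis.
From mathcomp Require Import measurable_realfun ring lra.

(** For [u, t > 0] consider the block of height [u] on [[0, t[]; its Cesaro mean
    at [x] is [Num.min u (u * t / x)].  The space contains the required copy
    of l^infty as soon as there are blocks of arbitrarily small length [t] and
    mass [u * t], or on the half line of arbitrarily large length and mass,
    that have a small modular but a large value of
    [t * phi ((1 + e) * u)].

    Indeed, choose a sequence of such blocks in which each one is negligible,
    in length and in mass [u * t], with respect to the preceding one (or to
    the following one, for long blocks), and let [f] be [u k] on
    [[eps k * t k, t k[] and 0 elsewhere.  At each [x] the integral of [f] over
    [[0, x]] is at most the integral of a single block ([decreasing_sum],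
    [increasing_sum]).  Thus [phi] of the Cesaro mean of [f] is at most the
    sum of the corresponding values for the blocks, although [phi] is not
    subadditive, and [f] has modular at most 1 ([cesaro_modular_blocks_le]).
    On the other hand, the piece of [f] on the block [k] alone has a mean close
    to [u k] on most of the block, so that after multiplication by any fixed
    [l > 1] its modular exceeds 1 for large [k] ([cesaro_modular_block_gt1]).
    Distributing the pieces over infinitely many infinite colour classes and
    mapping a bounded sequence [x] to [x (colour) * f] gives the isometry
    ([coloured_copy]).

    It remains to find the blocks.  If [phi] is finite at the endpoint [b] of
    its domain, short blocks of height [b] work ([small_blocks_jump]).
    Otherwise the convexity of the root of [phi] gives
    [phi v <= K * (v / u) ^ p * phi u] with [p > 1], at least for large [v],
    hence a bound of the modular of a block by a multiple of [t * phi u] and a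
    term that is small with the mass [u * t] ([block_modular_dyadic],
    [block_modular_small]).  A point [u] where the doubling condition fails
    makes [phi ((1 + e) * u) / phi u] large, and a suitable [t] of order
    [1 / phi u] then gives a good block: a short one when the failure occurs
    at large arguments ([small_blocks_Delta2]), a long one when it occurs near
    0 ([large_blocks_Delta2]). *)

Set Implicit Arguments.
Unset Strict Implicit.
Unset Printing Implicit Defensive.
Import Order.TTheory GRing.Theory Num.Theory.
Import numFieldNormedType.Exports.

Local Open Scope classical_set_scope.
Local Open Scope ring_scope.
Local Open Scope ereal_scope.

(** * Integrals of nonnegative functions over intervals *)

Section integration.

(** The integral of a nonnegative function is a supremum over the simple
    functions below it, so it is monotone on arbitrary functions.  The
    integrand of the modular contains a Cesaro mean; comparing it in this way
    avoids establishing its measurability. *)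
Lemma ge0_le_integral_any d (T : measurableType d) (R : realType)
    (mu : {measure set T -> \bar R}) (D : set T) (f g : T -> \bar R) :
  (forall x, D x -> 0 <= f x) -> (forall x, D x -> f x <= g x) ->
  \int[mu]_(x in D) f x <= \int[mu]_(x in D) g x.
Proof.
move=> f0 fg.
have g0 x : D x -> 0 <= g x by move=> Dx; apply: le_trans (fg _ Dx); exact: f0.
rewrite !ge0_integralE//; apply: le_ereal_sup => _ [h /= hf <-].
exists h => // x; apply: le_trans (hf x) _; rewrite /patch.
by case: ifPn => // /set_mem /fg.
Qed.

Lemma ge0_le_set_integral_any d (T : measurableType d) (R : realType)
    (mu : {measure set T -> \bar R}) (D E : set T) (f g : T -> \bar R) :
  (forall x, D x -> 0 <= f x) -> (forall x, E x -> 0 <= g x) -> D `<=` E ->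
  (forall x, D x -> f x <= g x) ->
  \int[mu]_(x in D) f x <= \int[mu]_(x in E) g x.
Proof.
move=> f0 g0 DE fg; rewrite integral_mkcond [leRHS]integral_mkcond.
apply: ge0_le_integral_any => x _; rewrite /patch.
  by case: ifPn => // /set_mem /f0.
case: ifPn => [/set_mem Dx|_]; first by rewrite ifT ?fg// inE; exact: DE.
by case: ifPn => // /set_mem /g0.
Qed.

Lemma nneseries_le_bound (R : realType) (u : (\bar R)^nat) (M : \bar R) :
  (forall n, 0 <= u n) -> (forall n, \sum_(0 <= i < n) u i <= M) ->
  \sum_(i <oo) u i <= M.
Proof.
move=> u0 uM; apply: lime_le; first exact: is_cvg_nneseries.
by apply: nearW => n; exact: uM.
Qed.

Lemma geometric_nneseries_le (R : realType) (a q : R) :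
  (0 <= a)%R -> (0 <= q < 1)%R ->
  \sum_(i <oo) (a * q ^+ i)%:E <= (a / (1 - q))%:E.
Proof.
move=> a0 /andP[q0 q1]; apply: nneseries_le_bound => [n|n].
  by rewrite lee_fin mulr_ge0// exprn_ge0.
rewrite sumEFin lee_fin.
have -> : (\sum_(0 <= i < n) a * q ^+ i)%R = series (geometric a q) n by [].
rewrite geometric_seriesE ?lt_eqF//= ler_pM2r ?invr_gt0 ?subr_gt0//.
by rewrite ler_piMr// gerBl exprn_ge0.
Qed.

Context {R : realType}.
Local Notation LR := (lebesgueTypeR R).

Lemma measurable_Lebesgue_itv (i : interval R) : measurable ([set` i] : set LR).
Proof. by apply: sub_caratheodory; exact: measurable_itv. Qed.

Lemma leb_mu_itv (i : interval R) : leb_mu ([set` i] : set LR) =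
  (if (i.1 < i.2)%E then (i.2 : \bar R) - i.1 else 0).
Proof. exact: (lebesgue_measure_itv i). Qed.

Lemma integral_cst_itv (i : interval R) (r : \bar R) :
  \int[leb_mu]_(x in ([set` i] : set LR)) cst r x =
  r * (if (i.1 < i.2)%E then (i.2 : \bar R) - i.1 else 0).
Proof.
rewrite integral_cst; last exact: measurable_Lebesgue_itv.
by congr (_ * _); exact: lebesgue_measure_itv.
Qed.

Lemma nonincreasing_emeasurable (D : set LR) (f : LR -> \bar R) :
  measurable D -> (forall x y : R, (x <= y)%R -> f y <= f x) ->
  measurable_fun D f.
Proof.
move=> mD fni.
apply: (measurability (@ErealGenCInfty.G R)) => [|/= _ [_] [r] -> <-].
  exact: ErealGenCInfty.measurableE.
apply: measurableI => //; apply: sub_caratheodory.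
apply: is_interval_measurable => s t/=.
rewrite !in_itv/= !andbT => fs ft u /andP[su ut].
by rewrite in_itv/= andbT (le_trans ft)// fni.
Qed.

End integration.

(** * Orlicz functions and the Cesaro modular *)

Section orlicz_basics.
Context {R : realType} (phi : R -> \bar R) (hphi : orlicz_function phi).

Lemma orlicz_scale (t u : R) : (0 <= u)%R -> (0 <= t <= 1)%R ->
  phi (t * u)%R <= t%:E * phi u.
Proof.
move=> u0 t01; have := orlicz_convex hphi u0 (lexx 0%R) t01.
by rewrite mulr0 addr0 (orlicz_0 hphi) mule0 adde0.
Qed.

(** Convexity together with [phi 0 = 0] makes [phi u / u] nondecreasing. *)
Lemma orlicz_ratio (v u : R) : (0 <= v <= u)%R -> (0 < u)%R ->
  phi v <= (v / u)%:E * phi u.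
Proof.
move=> /andP[v0 vu] u0; rewrite -[in leLHS](divfK (lt0r_neq0 u0) v).
by rewrite orlicz_scale ?(ltW u0)// divr_ge0 ?(ltW u0)//= ler_pdivrMr// mul1r.
Qed.

Lemma orlicz_mono (v u : R) : (0 <= v <= u)%R -> phi v <= phi u.
Proof.
move=> /andP[v0 vu]; have [u0|u0] := leP u 0%R.
  have -> // : v = u.
  by apply/le_anti; rewrite vu (le_trans u0).
apply: (le_trans (@orlicz_ratio v u _ u0)); first by rewrite v0.
rewrite gee_pMl ?(orlicz_ge0 hphi) ?(ltW u0)// lee_fin.
by rewrite ler_pdivrMr// mul1r.
Qed.

Lemma orlicz_ext_ge0 (y : \bar R) : 0 <= y -> 0 <= orlicz_ext phi y.
Proof. by case: y => //= u; rewrite lee_fin => u0; exact: orlicz_ge0. Qed.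

Lemma orlicz_ext_mono (x y : \bar R) : 0 <= x -> x <= y ->
  orlicz_ext phi x <= orlicz_ext phi y.
Proof.
case: y => [v||]; last 2 first.
- by move=> _ _; rewrite /= leey.
- by rewrite leeNy_eq => x0 /eqP xE; rewrite xE in x0.
case: x => //= u; rewrite !lee_fin => u0 uv.
by apply: orlicz_mono; rewrite u0.
Qed.

Lemma cesaro_op_ge0 (f : R -> \bar R) (x : R) :
  (0 <= x)%R -> (forall t, 0 <= f t) -> 0 <= cesaro_op f x.
Proof.
by move=> x0 f0; rewrite mule_ge0 ?lee_fin ?invr_ge0//; apply: integral_ge0.
Qed.

Lemma base_set_ge0 (I : base_interval) (x : R) : base_set I x -> (0 <= x)%R.
Proof. by case: I; rewrite /= in_itv/= => /andP[]. Qed.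

Lemma cesaro_modular_mono (I : base_interval) (f g : R -> R) :
  (forall t, `|f t| <= `|g t|)%R ->
  cesaro_modular I phi f <= cesaro_modular I phi g.
Proof.
move=> fg; apply: ge0_le_integral_any => x Ix; first exact: orlicz_ext_ge0.
have x0 := base_set_ge0 Ix.
have C0 h : 0 <= cesaro_op (fun t => (`|h t|%R)%:E) x.
  by apply: cesaro_op_ge0 => // t; rewrite lee_fin.
apply: orlicz_ext_mono => //; rewrite !gee0_abs//.
apply: lee_wpmul2l; first by rewrite lee_fin invr_ge0.
by apply: ge0_le_integral_any => t _; rewrite lee_fin.
Qed.

(** The Cesaro mean at [x > 0] of the function equal to [u] on [[0, c / u[]
    and to 0 beyond.  Nonpositive [x] get the value [u], which makes it
    nonincreasing on the whole line and hence measurable after composition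
    with an Orlicz function. *)
Definition block_mean (u c x : R) : R :=
  if (x <= 0)%R then u else Num.min u (c / x)%R.

Lemma block_mean_ge0 u c x : (0 <= u)%R -> (0 <= c)%R ->
  (0 <= block_mean u c x)%R.
Proof.
rewrite /block_mean => u0 c0; case: (leP x 0%R) => // x0.
by rewrite le_min u0 divr_ge0// ltW.
Qed.

Lemma block_mean_le u c x : (block_mean u c x <= u)%R.
Proof.
by rewrite /block_mean; case: (leP x 0%R) => // x0; rewrite ge_min lexx.
Qed.

Lemma block_mean_div u c x : (0 < x)%R -> (block_mean u c x <= c / x)%R.
Proof. by move=> x0; rewrite /block_mean (lt_geF x0) ge_min lexx orbT. Qed.

Lemma block_mean_anti u c x y : (0 <= c)%R -> (x <= y)%R ->
  (block_mean u c y <= block_mean u c x)%R.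
Proof.
move=> c0 xy; rewrite {2}/block_mean; case: (leP x 0%R) => x0.
  exact: block_mean_le.
rewrite le_min block_mean_le/= (le_trans (block_mean_div _ _ _))//.
  exact: lt_le_trans xy.
by rewrite ler_wpM2l// lef_pV2// posrE// (lt_le_trans x0).
Qed.

Lemma measurable_orlicz_block_mean (D : set (lebesgueTypeR R)) u c :
  measurable D -> (0 <= u)%R -> (0 <= c)%R ->
  measurable_fun D (fun x : lebesgueTypeR R => phi (block_mean u c x)).
Proof.
move=> mD u0 c0; apply: nonincreasing_emeasurable => // x y xy.
by apply: orlicz_mono; rewrite block_mean_ge0//= block_mean_anti.
Qed.

(** The value of [cesaro_modular] at [u] times the indicator of [[0, c / u[].
    The parameters are the height [u] and the mass [c] of the block. *)
Definition block_modular (I : base_interval) (u c : R) : \bar R :=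
  \int[leb_mu]_(x in (base_set I : set (lebesgueTypeR R)))
    phi (block_mean u c x).

Lemma measurable_base_set (I : base_interval) :
  measurable (base_set I : set (lebesgueTypeR R)).
Proof. by case: I; exact: measurable_Lebesgue_itv. Qed.

End orlicz_basics.

(** * Copies of l^infty from a coloured function *)

Section coloured_copy.
Context {R : realType}.

Lemma linfty_norm_ub (x : nat -> R) : linfty x ->
  forall n, (`|x n| <= linfty_norm x)%R.
Proof.
move=> [M [_ xM]] n; apply: sup_upper_bound; last by exists n.
split; first by exists `|x 0%N|%R; exists 0%N.
by exists (M + 1)%R => _ [m _ <-]; apply: (xM (M + 1)%R) => //; rewrite ltrDl.
Qed.

Lemma linfty_norm_lt (x : nat -> R) (l : R) : (l < linfty_norm x)%R ->
  exists n, (l < `|x n|)%R.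
Proof.
move=> lx; have [|_ [n _ <-] ln] := @sup_gt _ _ l _ lx; last by exists n.
by exists `|x 0%N|%R; exists 0%N.
Qed.

Lemma linfty_norm_ge0 (x : nat -> R) : linfty x -> (0 <= linfty_norm x)%R.
Proof. by move=> /linfty_norm_ub /(_ 0%N); exact: le_trans. Qed.

(** Colour the line by the naturals through [c] and send [x] to the
    function [x (c t) * f t].  If [f] has modular at most 1, the image of [x]
    has norm at most [linfty_norm x], because it is dominated by
    [linfty_norm x * f].  If the restriction of [f] to each colour class
    leaves the unit ball of the modular under every dilation by a factor
    [l > 1], the norm is also at least every [`|x n|], because the image
    dominates [`|x n|] times the restriction of [f] to the colour [n]. *)
Lemma coloured_copy (I : base_interval) (phi : R -> \bar R)
    (f : R -> R) (c : R -> nat) :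
  orlicz_function phi ->
  (forall t, (0 <= f t)%R) ->
  (forall x : nat -> R,
     measurable_fun setT (fun t : lebesgueTypeR R => x (c t) * f t)%R) ->
  cesaro_modular I phi f <= 1 ->
  (forall n (l : R), (1 < l)%R ->
     1 < cesaro_modular I phi (fun t => l * ((c t == n)%:R * f t))%R) ->
  contains_order_isometric_copy_of_linfty I (Ces I phi) (Ces_norm I phi).
Proof.
move=> hphi f0 mf rf rfn.
pose T (x : nat -> R) (t : R) := (x (c t) * f t)%R.
have Tle x l : linfty x -> (0 < l)%R -> (linfty_norm x <= l)%R ->
    cesaro_modular I phi (fun t => T x t / l)%R <= 1.
  move=> bx l0 xl; apply: le_trans rf; apply: cesaro_modular_mono => // t.
  rewrite /T mulrAC normrM ler_piMl// normrM normfV (gtr0_norm l0).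
  by rewrite ler_pdivrMr// mul1r (le_trans (linfty_norm_ub bx _)).
have Tgt x l : linfty x -> (0 < l)%R -> (l < linfty_norm x)%R ->
    1 < cesaro_modular I phi (fun t => T x t / l)%R.
  move=> bx l0 /linfty_norm_lt[n ln].
  have /(rfn n) : (1 < `|x n| / l)%R by rewrite ltr_pdivlMr// mul1r.
  move=> /lt_le_trans; apply; apply: cesaro_modular_mono => // t.
  rewrite /T !normrM normr_id normr_nat; have [->|_] := eqVneq (c t) n.
    by rewrite mul1r mulrAC.
  by rewrite mul0r mulr0 !mulr_ge0.
exists T; split.
- move=> x bx; split; first exact: measurable_funS (mf x).
  exists (linfty_norm x + 1)%R; first by rewrite ltr_wpDl// linfty_norm_ge0.
  apply: (@le_lt_trans _ _ 1); last exact: ltry.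
  by apply: (Tle x _ bx); rewrite ?ltr_wpDl ?linfty_norm_ge0// lerDl.
- move=> a x y _ _; apply: aeW => t _ /=.
  by rewrite /T mulrDl mulrA.
- move=> x bx; apply/le_anti/andP; split.
    apply/lee_addgt0Pr => e e0; apply: ge_ereal_inf => /=.
    exists (linfty_norm x + e)%:E; last by rewrite EFinD.
    exists (linfty_norm x + e)%R; last by [].
    have l0 : (0 < linfty_norm x + e)%R by rewrite ltr_wpDl// linfty_norm_ge0.
    split; first by [].
    by apply: (Tle x _ bx l0); rewrite lerDl ltW.
  apply: le_ereal_inf_tmp => _ [l [l0 lx] <-]; rewrite lee_fin leNgt.
  by apply/negP => /(Tgt _ _ bx l0); rewrite ltNge lx.
- move=> x bx; split=> [x0|Tx0 n].
    by apply: aeW => t _; rewrite /T mulr_ge0.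
  rewrite leNgt; apply/negP => xn0.
  (* If x n < 0 while T x >= 0 almost everywhere, f vanishes almost everywhere
     on the colour class n, so no dilation of it has a positive modular. *)
  have : 1 < cesaro_modular I phi (fun t => 2 * ((c t == n)%:R * f t))%R.
    by apply: rfn; rewrite ltr1n.
  suff -> : cesaro_modular I phi (fun t => 2 * ((c t == n)%:R * f t))%R = 0.
    by rewrite lte_fin ltr10.
  apply: integral0_eq => z Iz.
  suff -> : cesaro_op (fun t => `|2 * ((c t == n)%:R * f t)|%R%:E) z = 0.
    by rewrite abse0 /= (orlicz_0 hphi).
  rewrite /cesaro_op; set J := (X in X * _); rewrite -[RHS](mule0 J).
  congr (_ * _).
  rewrite -[RHS](integral0 leb_mu (`[0%R, z] : set (lebesgueTypeR R))).
  have zI : `[0%R, z] `<=` base_set I.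
    move=> t /=; rewrite in_itv/= => /andP[t0 tz].
    case: (I) Iz => /=; rewrite !in_itv/= t0 ?andbT// => /andP[_].
    exact: le_trans.
  have mG : measurable_fun (`[0%R, z] : set (lebesgueTypeR R))
      (fun t : lebesgueTypeR R => 2 * ((c t == n)%:R * f t))%R.
    apply: measurable_funM; first exact: measurable_cst.
    exact: measurable_funS (@measurableT _ _) (@subsetT _ _)
      (mf (fun m => (m == n)%:R)).
  apply: ae_eq_integral.
  - exact: measurable_Lebesgue_itv.
  - apply/measurable_EFinP; apply: measurableT_comp; last exact: mG.
    exact: normr_measurable.
  - exact: measurable_cst.
  move: Tx0; apply: filterS => t Tt zt /=.
  have := Tt (zI _ zt); rewrite /T; have [->|_] := eqVneq (c t) n; last first.
    by rewrite mul0r mulr0 normr0.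
  rewrite nmulr_rge0// => ft.
  have -> : f t = 0%R by apply/le_anti; rewrite ft f0.
  by rewrite !mulr0 normr0.
Qed.

End coloured_copy.

(** * Step functions on disjoint blocks *)

Section block_index.
Context {R : realType}.
Local Notation LR := (lebesgueTypeR R).

(** The index of the set containing [t], shifted by one so that 0 stands for
    the points outside all the sets. *)
Definition block_index (J : nat -> set R) (t : R) : nat :=
  if pselect (exists k, J k t) is left h then (projT1 (cid h)).+1 else 0%N.

Lemma block_indexS (J : nat -> set R) : trivIset setT J ->
  forall t k, block_index J t = k.+1 <-> J k t.
Proof.
move=> trivJ t k; rewrite /block_index; case: pselect => [h|h]; last first.
  by split=> // Jkt; case: h; exists k.
case: cid => /= m Jmt; split=> [[<-]//|Jkt].
by congr S; apply: (trivJ m k) => //; exists t.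
Qed.

(** Every function that depends on [t] only through the block containing it
    has countably many level sets, each a union of blocks, possibly together
    with the complement of all the blocks. *)
Lemma measurable_block_index (J : nat -> set R) (g : nat -> R) :
  trivIset setT J -> (forall k, measurable (J k : set LR)) ->
  measurable_fun setT (fun t : LR => g (block_index J t)).
Proof.
move=> trivJ mJ _ B mB; rewrite setTI.
have -> : (fun t : LR => g (block_index J t)) @^-1` B =
    \bigcup_(k in [set k | B (g k)]) [set t | block_index J t = k].
  apply/seteqP; split=> [t Bt|t [k /= Bk tk]] /=; last by rewrite tk.
  by exists (block_index J t).
apply: bigcup_measurable => -[|k] _; last first.
  suff -> : [set t | block_index J t = k.+1] = J k by exact: mJ.
  by apply/seteqP; split=> t /(block_indexS trivJ).
have -> : [set t | block_index J t = 0%N] = ~` (\bigcup_k J k).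
  apply/seteqP; split=> t /=.
    by move=> t0 [k _ /(block_indexS trivJ)]; rewrite t0.
  case E : (block_index J t) => [//|k] h; case: h; exists k => //.
  exact/(block_indexS trivJ).
by apply: measurableC; apply: bigcup_measurable => k _; exact: mJ.
Qed.

End block_index.

(** Colouring the block [k] by the 2-adic valuation of [k.+1] gives each colour
    to infinitely many blocks. *)
Lemma logn2_infinitely_often (n N : nat) :
  exists2 k : nat, (N <= k)%N & logn 2 k.+1 = n.
Proof.
have pos : (0 < 2 ^ n * N.*2.+1)%N by rewrite muln_gt0 expn_gt0.
exists (2 ^ n * N.*2.+1).-1; last first.
  rewrite prednK// lognM ?expn_gt0// pfactorK// lognE /= dvdn2 /= odd_double.
  by rewrite addn0.
rewrite -ltnS prednK// (@leq_trans N.*2.+1)//.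
  by rewrite ltnS -addnn leq_addr.
by rewrite leq_pmull// expn_gt0.
Qed.

Section blocks_copy.
Context {R : realType}.
Local Notation LR := (lebesgueTypeR R).
Implicit Types (u t : nat -> R).

(** A summable sequence, used both as the tolerance of the estimates on the
    block [k] and as the ratio of the endpoints of that block.  The exponent
    [k.+2] makes its sum 1/2 and each term at most 1/4. *)
Definition eps (k : nat) : R := (2 ^+ k.+2)^-1.

Lemma eps_gt0 k : (0 < eps k)%R.
Proof. by rewrite invr_gt0 exprn_gt0. Qed.

Lemma epsE k : eps k = (4^-1 * 2^-1 ^+ k)%R.
Proof.
by rewrite /eps -!exprVn !exprS mulrA; congr (_ * _)%R; field.
Qed.

Lemma eps_le4 k : (eps k <= 4^-1)%R.
Proof. by rewrite epsE ler_piMr// exprn_ile1// invf_le1 ?ler1n. Qed.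

Lemma eps_small (d : R) : (0 < d)%R ->
  exists N, forall k, (N <= k)%N -> (eps k <= d)%R.
Proof.
move=> d0; pose N := Num.bound d^-1.
exists N => k Nk; rewrite -[leRHS]invrK lef_pV2 ?posrE ?invr_gt0// ?exprn_gt0//.
rewrite ltW// (lt_le_trans (archi_boundP _)) ?invr_ge0 ?(ltW d0)//.
rewrite -natrX ler_nat (leq_trans (ltnW (ltn_expl N (isT : 1 < 2)%N)))//.
by rewrite leq_exp2l// (leq_trans Nk)// -addn2 leq_addr.
Qed.

Definition block u t k : set R := `[(eps k * t k)%R, t k[%classic.

(** The length of [block u t k] below [x], for [x >= 0]. *)
Definition block_part t k (x : R) : R :=
  Num.max 0%R (Num.min x (t k) - eps k * t k)%R.

Definition blocks_fun u t (x : R) : R :=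
  if block_index (block u t) x is k.+1 then u k else 0%R.

Lemma blocks_funE u t k x : trivIset setT (block u t) -> block u t k x ->
  blocks_fun u t x = u k.
Proof. by move=> trivJ /(block_indexS trivJ); rewrite /blocks_fun => ->. Qed.

Lemma blocks_fun_ge0 u t x : (forall k, 0 < u k)%R -> (0 <= blocks_fun u t x)%R.
Proof.
by rewrite /blocks_fun => u0; case: (block_index _ x) => // k; rewrite ltW.
Qed.

Lemma leb_mu_block_le u t k z :
  leb_mu ((block u t k `&` `[0%R, z]) : set LR) <= (block_part t k z)%:E.
Proof.
apply: (@le_trans _ _ (leb_mu
    (`[(eps k * t k)%R, (Num.min z (t k))] : set LR))).
  apply: le_measure; rewrite ?inE; first apply: measurableI.
  - exact: measurable_Lebesgue_itv.
  - exact: measurable_Lebesgue_itv.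
  - exact: measurable_Lebesgue_itv.
  - move=> x []; rewrite /block /= !in_itv/= => /andP[-> xt] /andP[_ xz].
    by rewrite le_min xz ltW.
rewrite leb_mu_itv /= lte_fin /block_part; case: ifPn => // _.
  by rewrite -EFinB lee_fin le_max lexx orbT.
by rewrite lee_fin le_max lexx.
Qed.

Lemma integral_blocks_fun_le u t z (M : R) :
  (forall k, 0 < u k)%R -> trivIset setT (block u t) ->
  (forall n, \sum_(0 <= k < n) u k * block_part t k z <= M)%R ->
  \int[leb_mu]_(x in (`[0%R, z] : set LR)) (`|blocks_fun u t x|)%:E <= M%:E.
Proof.
move=> u0 trivJ hM.
have mJ k : measurable (block u t k : set LR) := measurable_Lebesgue_itv _.
have mz : measurable (`[0%R, z] : set LR) := measurable_Lebesgue_itv _.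
pose g k (x : LR) : \bar R := (u k)%:E * (\1_(block u t k) x)%:E.
have mg k : measurable_fun (`[0%R, z] : set LR) (g k).
  apply: emeasurable_funM; first exact: measurable_cst.
  apply/measurable_EFinP; apply: measurable_indic; exact: mJ.
have g0 k x : 0 <= g k x by rewrite mule_ge0// lee_fin ltW.
apply: (@le_trans _ _ (\int[leb_mu]_(x in (`[0%R, z] : set LR))
    \sum_(k <oo) g k x)).
  apply: ge0_le_integral_any => x _; first by rewrite lee_fin.
  rewrite ger0_norm ?blocks_fun_ge0//.
  have [[k Jk]|nJ] := pselect (exists k, block u t k x).
    rewrite (blocks_funE trivJ Jk).
    apply: le_trans (nneseries_lim_ge k.+1 _) => //.
    rewrite big_nat_recr//= /g indicE mem_set// mule1.
    by apply: leeDr; apply: sume_ge0 => i _; exact: g0.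
  rewrite /blocks_fun; case E : (block_index _ x) => [|k].
    by apply: nneseries_ge0 => ? _ _; exact: g0.
  by case: nJ; exists k; exact/(block_indexS trivJ).
rewrite integral_nneseries//.
apply: nneseries_le_bound => n; first by apply: integral_ge0.
apply: (@le_trans _ _ (\sum_(0 <= k < n) (u k * block_part t k z)%:E)).
  apply: lee_sum => k _; rewrite EFinM.
  have mi : measurable_fun (`[0%R, z] : set LR)
      (fun x : LR => (\1_(block u t k) x)%:E : \bar R).
    by apply/measurable_EFinP; apply: measurable_indic; exact: mJ.
  have -> : \int[leb_mu]_(x in (`[0%R, z] : set LR)) g k x =
      (u k)%:E * leb_mu ((block u t k `&` `[0%R, z]) : set LR).
    rewrite -(integral_indic leb_mu mz (mJ k)).
    by apply: (ge0_integralZl leb_mu mz mi); rewrite ?lee_fin ?ltW.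
  apply: lee_wpmul2l; first by rewrite lee_fin ltW.
  exact: leb_mu_block_le.
by rewrite sumEFin lee_fin.
Qed.

End blocks_copy.

(** * The Cesaro modular of a step function *)

Section blocks_theorem.
Context {R : realType}.
Local Notation LR := (lebesgueTypeR R).

(** If the integral of the step function over [[0, x]] is at most
    [u k * Num.min x (t k)] for some [k], the Cesaro mean at [x] is at most
    [block_mean (u k) (u k * t k) x].  Hence [phi] of the Cesaro mean is
    bounded by a single term of the series of the block integrands, and the
    modular is bounded by the sum of the block modulars.  Passing through the
    largest block only is what replaces subadditivity, which [phi] lacks. *)
Lemma cesaro_modular_blocks_le (I : base_interval) (phi : R -> \bar R)
    (u t : nat -> R) :
  orlicz_function phi ->
  (forall k, 0 < u k)%R -> (forall k, 0 < t k)%R ->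
  trivIset setT (block u t) ->
  (forall x, (0 < x)%R -> exists k, forall n,
     (\sum_(0 <= j < n) u j * block_part t j x <= u k * Num.min x (t k))%R) ->
  (forall k, block_modular phi I (u k) (u k * t k)%R <= (eps k)%:E) ->
  cesaro_modular I phi (blocks_fun u t) <= 1.
Proof.
move=> hphi u0 t0 trivJ hsum hmod.
have mI := measurable_base_set (R := R) I.
pose g k (x : LR) : \bar R := phi (block_mean (u k) (u k * t k)%R x).
have mg k : measurable_fun (base_set I : set LR) (g k).
  by apply: measurable_orlicz_block_mean; rewrite ?mulr_ge0// ltW.
have g0 k x : 0 <= g k x.
  by apply: (orlicz_ge0 hphi); rewrite block_mean_ge0 ?mulr_ge0// ltW.
apply: (@le_trans _ _
    (\int[leb_mu]_(x in (base_set I : set LR)) \sum_(k <oo) g k x)).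
  apply: ge0_le_integral_any => x Ix; first exact: orlicz_ext_ge0.
  have := base_set_ge0 Ix; rewrite le_eqVlt => /predU1P[<-|x0].
    rewrite /cesaro_op invr0 mul0e abse0 /= (orlicz_0 hphi).
    by apply: nneseries_ge0 => k _ _; exact: g0.
  have [k hk] := hsum x x0.
  apply: (@le_trans _ _ (g k x)); last first.
    apply: le_trans (nneseries_lim_ge k.+1 _) => //.
    by rewrite big_nat_recr//=; apply: leeDr; apply: sume_ge0 => i _; exact: g0.
  apply: (@orlicz_ext_mono _ _ hphi _
    (block_mean (u k) (u k * t k)%R x)%:E) => //.
  have C0 : 0 <= cesaro_op (fun s => `|blocks_fun u t s|%R%:E) x.
    by apply: cesaro_op_ge0 => [|s]; rewrite ?lee_fin// ltW.
  rewrite gee0_abs// /cesaro_op.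
  apply: (@le_trans _ _ ((x^-1)%:E * (u k * Num.min x (t k))%:E)).
    apply: lee_wpmul2l; first by rewrite lee_fin invr_ge0 ltW.
    exact: integral_blocks_fun_le.
  rewrite -EFinM lee_fin /block_mean (lt_geF x0) le_min mulrC.
  rewrite ler_pdivrMr// ler_pM2l// ge_min lexx/=.
  by rewrite ler_pM2r ?invr_gt0// ler_pM2l// ge_min lexx orbT.
rewrite integral_nneseries//.
apply: (@le_trans _ _ (\sum_(k <oo) (eps k)%:E)).
  apply: lee_nneseries => [k _ _|k _]; last exact: hmod.
  by apply: integral_ge0 => x _; exact: g0.
apply: (@le_trans _ _ (\sum_(k <oo) (4^-1 * 2^-1 ^+ k)%:E)).
  apply: lee_nneseries => [k _ _|k _]; last by rewrite lee_fin epsE.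
  by rewrite lee_fin; exact/ltW/eps_gt0.
apply: le_trans (geometric_nneseries_le _ _) _; first by rewrite invr_ge0.
  by apply/andP; split; lra.
by rewrite lee_fin ler_pdivrMr; lra.
Qed.

(** On the right half [[t k / 2, t k[] of a block that starts at
    [eps k * t k], the mean of a function which is at least [l * u k] on the
    block is at least [l * (1 - 2 * eps k) * u k].  This loss is absorbed by
    [l > 1] once [eps k] is small, and the modular is then at least
    [t k / 2 * phi ((1 + eps k) * u k)]. *)
Lemma cesaro_modular_block_gt1 (I : base_interval) (phi : R -> \bar R)
    (u t : nat -> R) (g : R -> R) (k : nat) (l : R) :
  orlicz_function phi -> (0 < u k)%R -> (0 < t k)%R ->
  block u t k `<=` base_set I ->
  (0 <= l)%R -> (1 + eps k <= l * (1 - 2 * eps k))%R ->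
  (forall s, block u t k s -> l * u k <= `|g s|)%R ->
  3 < (t k)%:E * phi ((1 + eps k) * u k)%R ->
  1 < cesaro_modular I phi g.
Proof.
move=> hphi u0 t0 JI l0 le hg h3.
have e4 := eps_le4 (R := R) k; have e0 := eps_gt0 (R := R) k.
have v0 : (0 <= (1 + eps k) * u k)%R.
  by rewrite mulr_ge0 ?(ltW u0)// addr_ge0// ltW.
have ph0 := orlicz_ge0 hphi v0.
pose D : set LR := `[(t k / 2)%R, t k[%classic.
have mD : measurable D := measurable_Lebesgue_itv _.
apply: (@lt_le_trans _ _
    (\int[leb_mu]_(x in D) (cst (phi ((1 + eps k) * u k)%R) x))).
  rewrite /D integral_cst_itv /= lte_fin ifT; last by lra.
  rewrite muleC -EFinB (_ : (t k - t k / 2 = 2^-1 * t k)%R); last by field.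
  rewrite EFinM -muleA.
  apply: (@lt_le_trans _ _ ((2^-1)%:E * 3)).
    by rewrite -EFinM lte_fin; lra.
  by apply: lee_wpmul2l; [rewrite lee_fin; lra|exact: ltW].
have DJ : D `<=` block u t k.
  move=> x; rewrite /D /block /= !in_itv/= => /andP[tx ->]; rewrite andbT.
  apply: le_trans tx; rewrite mulrC ler_pM2l//; lra.
apply: ge0_le_set_integral_any => // [x _|x Dx|x Dx].
- exact: orlicz_ext_ge0.
- exact/JI/DJ.
have [tx xt] : (t k / 2 <= x)%R /\ (x < t k)%R.
  by move: Dx; rewrite /D /= in_itv/= => /andP[].
have x0 : (0 < x)%R by lra.
have C0 : 0 <= cesaro_op (fun s => `|g s|%R%:E) x.
  by apply: cesaro_op_ge0 => [|s]; rewrite ?lee_fin// ltW.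
apply: (@orlicz_ext_mono _ _ hphi ((1 + eps k) * u k)%:E) => //.
rewrite gee0_abs//.
have etx : (eps k * t k < x)%R.
  apply: lt_le_trans tx; rewrite mulrC ltr_pM2l//; lra.
apply: (@le_trans _ _ ((x^-1)%:E *
    \int[leb_mu]_(s in (`[(eps k * t k)%R, x[ : set LR)) cst (l * u k)%:E s)).
  rewrite integral_cst_itv /= lte_fin etx -EFinB.
  rewrite -!EFinM lee_fin.
  rewrite [leRHS]mulrC ler_pdivlMr// [leLHS]mulrAC [leRHS]mulrAC ler_pM2r//.
  apply: (@le_trans _ _ (l * (1 - 2 * eps k) * x)%R).
    by rewrite ler_pM2r.
  rewrite -mulrA ler_wpM2l// mulrBl mul1r lerD2l lerN2.
  by rewrite -mulrA mulrCA ler_pM2l//; lra.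
apply: lee_wpmul2l; first by rewrite lee_fin invr_ge0 ltW.
apply: ge0_le_set_integral_any => [s _|s _|s /=|s].
- by rewrite lee_fin mulr_ge0// ltW.
- by rewrite lee_fin.
- rewrite !in_itv/= => /andP[es sx]; rewrite (ltW sx) andbT.
  by apply: le_trans es; rewrite mulr_ge0// ltW.
rewrite /= in_itv/= => /andP[es sx]; rewrite lee_fin; apply: hg.
by rewrite /block /= in_itv/= es (lt_trans sx).
Qed.

(** The two estimates above turn a suitable sequence of blocks into a
    coloured function as in [coloured_copy]. *)
Lemma blocks_copy (I : base_interval) (phi : R -> \bar R) (u t : nat -> R) :
  orlicz_function phi ->
  (forall k, 0 < u k)%R -> (forall k, 0 < t k)%R ->
  trivIset setT (block u t) ->
  (forall k, block u t k `<=` base_set I) ->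
  (forall x, (0 < x)%R -> exists k, forall n,
     (\sum_(0 <= j < n) u j * block_part t j x <= u k * Num.min x (t k))%R) ->
  (forall k, block_modular phi I (u k) (u k * t k)%R <= (eps k)%:E) ->
  (forall k, 3 < (t k)%:E * phi ((1 + eps k) * u k)%R) ->
  contains_order_isometric_copy_of_linfty I (Ces I phi) (Ces_norm I phi).
Proof.
move=> hphi u0 t0 trivJ JI hsum hmod h3.
pose c s : nat :=
  if block_index (block u t) s is k.+1 then logn 2 k.+1 else 0%N.
apply: (@coloured_copy _ I phi (blocks_fun u t) c hphi).
- by move=> s; exact: blocks_fun_ge0.
- move=> x; pose h k : R :=
    if k is j.+1 then (x (logn 2 j.+1) * u j)%R else 0%R.
  rewrite (_ : (fun s : LR => _) = fun s : LR => h (block_index (block u t) s)).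
    by apply: measurable_block_index => // k; exact: measurable_Lebesgue_itv.
  apply/funext => s; rewrite /h /blocks_fun /c.
  by case: (block_index _ s) => //; rewrite mulr0.
- exact: cesaro_modular_blocks_le.
- move=> n l l1.
  have [|N hN] := @eps_small R ((l - 1) / (1 + 2 * l))%R.
    by rewrite divr_gt0//; lra.
  have [k Nk kn] := logn2_infinitely_often n N.
  have := hN _ Nk; rewrite ler_pdivlMr; last lra.
  move=> hk; apply: (@cesaro_modular_block_gt1 I phi u t _ k l) => //.
  + by lra.
  + by lra.
  + move=> s Js; rewrite (blocks_funE trivJ Js) /c.
    have -> : block_index (block u t) s = k.+1 by exact/(block_indexS trivJ).
    by rewrite kn eqxx mul1r ger0_norm// mulr_ge0// ltW//; lra.
Qed.

End blocks_theorem.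

(** * Blocks shrinking to the origin or growing to infinity *)

Section block_sequences.
Context {R : realType}.
Implicit Types (u t : nat -> R).

Lemma block_part_ge0 t k x : (0 <= block_part t k x)%R.
Proof. by rewrite /block_part le_max lexx. Qed.

Lemma eps_lt1 k : (eps k < 1 :> R)%R.
Proof. by apply: le_lt_trans (eps_le4 k) _; rewrite invf_lt1 ?ltr1n. Qed.

Lemma block_part_le t k x : (0 < t k)%R ->
  (block_part t k x <= t k - eps k * t k)%R.
Proof.
move=> t0; rewrite /block_part ge_max subr_ge0 ler_piMl ?(ltW t0)//=.
  by rewrite lerD2r ge_min lexx orbT.
exact/ltW/eps_lt1.
Qed.

Lemma block_part_out t k x : (x <= eps k * t k)%R -> block_part t k x = 0%R.
Proof.
move=> xt; apply/max_idPl; rewrite subr_le0 (le_trans _ xt)//.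
by rewrite ge_min lexx.
Qed.

Lemma block_part_in t k x : (0 < t k)%R -> (eps k * t k <= x)%R ->
  block_part t k x = (Num.min x (t k) - eps k * t k)%R.
Proof.
move=> t0 xt; apply/max_idPr; rewrite subr_ge0 le_min xt/=.
by rewrite ler_piMl ?(ltW t0)// ltW// eps_lt1.
Qed.

Section decreasing.
Context (u t : nat -> R)
  (u0 : forall k, (0 < u k)%R) (t0 : forall k, (0 < t k)%R)
  (t_step : forall k, (t k.+1 <= eps k * t k)%R)
  (c_step : forall k, (u k.+1 * t k.+1 <= eps k * (u k * t k))%R)
  (t_le1 : (t 0%N <= 1)%R).

Lemma decreasing_t_le k j : (k < j)%N -> (t j <= eps k * t k)%R.
Proof.
elim: j => // j IH; rewrite ltnS leq_eqVlt => /predU1P[->//|/IH].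
apply: le_trans; apply: le_trans (t_step j) _.
by rewrite ler_piMl ?ltW// eps_lt1.
Qed.

Lemma decreasing_t_le1 k : (t k <= 1)%R.
Proof.
case: k => // k; apply: le_trans (decreasing_t_le (ltn0Sn k)) _.
by rewrite mulr_ile1 ?(ltW (eps_gt0 _)) ?(ltW (t0 _)) ?(ltW (eps_lt1 _)).
Qed.

Lemma decreasing_trivIset : trivIset setT (block u t).
Proof.
apply: ltn_trivIset => j k kj; rewrite -subset0 => x [] /=.
rewrite /block /= !in_itv/= => /andP[tx _] /andP[_ xt].
have := lt_le_trans xt (decreasing_t_le kj).
by rewrite ltNge tx.
Qed.

(** At [x], let [k] be the first block beginning before [x].  The later blocks
    lie closer to the origin, and their masses telescope to at most
    [u k.+1 * t k.+1], which is at most [u k * (eps k * t k)], the mass that a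
    function equal to [u k] would have before the block [k]. *)
Lemma decreasing_sum x : (0 < x)%R -> exists k, forall n,
  (\sum_(0 <= j < n) u j * block_part t j x <= u k * Num.min x (t k))%R.
Proof.
move=> x0.
have exk : exists k, (eps k * t k <= x)%R.
  have [N hN] := eps_small x0; exists N; apply: le_trans (hN N (leqnn N)).
  by rewrite ler_piMr ?decreasing_t_le1// ltW// eps_gt0.
case: (ex_minnP exk) => k kx kmin; exists k => n.
have out j : (j < k)%N -> block_part t j x = 0%R.
  move=> jk; apply: block_part_out; rewrite leNgt; apply/negP => /ltW /kmin.
  by rewrite leqNgt jk.
have [nk|kn] := leqP n k.
  rewrite big_nat_cond big1; last first.
    by move=> j /andP[/andP[_ jn] _]; rewrite out ?mulr0// (leq_trans jn).
  by rewrite mulr_ge0 ?(ltW (u0 k))// le_min !ltW.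
rewrite (big_cat_nat (leq0n k) (ltnW kn))/= [X in (X + _)%R]big_nat_cond.
rewrite big1; last first.
  by move=> j /andP[/andP[_ jk] _]; rewrite out ?mulr0.
rewrite add0r big_ltn// block_part_in// mulrBr.
rewrite -[leRHS]addr0 -addrA lerD2l addrC subr_le0 mulrCA.
apply: le_trans (c_step k).
apply: (@le_trans _ _
    (\sum_(k.+1 <= j < n) (- (u j.+1 * t j.+1) - - (u j * t j)))%R).
  apply: ler_sum => j _; rewrite opprK addrC.
  apply: (@le_trans _ _ (u j * (t j - eps j * t j)))%R.
    by rewrite ler_pM2l// block_part_le.
  by rewrite mulrBr lerD2l lerN2 mulrCA.
rewrite (telescope_sumr (fun j => - (u j * t j)))%R// opprK addrC gerBl.
by rewrite mulr_ge0 ?ltW.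
Qed.

End decreasing.

Section increasing.
Context (u t : nat -> R)
  (u0 : forall k, (0 < u k)%R) (t0 : forall k, (0 < t k)%R)
  (t_step : forall k, (t k <= eps k.+1 * t k.+1)%R)
  (c_step : forall k, (u k * t k <= eps k.+1 * (u k.+1 * t k.+1))%R)
  (t_ge1 : (1 <= t 0%N)%R).

Lemma increasing_t_le k j : (k < j)%N -> (t k <= eps j * t j)%R.
Proof.
elim: j => // j IH; rewrite ltnS leq_eqVlt => /predU1P[->//|/IH].
move=> /le_trans; apply; apply: le_trans (t_step j).
by rewrite ler_piMl ?ltW// eps_lt1.
Qed.

Lemma increasing_t_ge k : (k.+1%:R <= t k)%R.
Proof.
elim: k => // k IH.
have : (t k <= 4^-1 * t k.+1)%R.
  by apply: le_trans (t_step k) _; rewrite ler_pM2r// eps_le4.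
have : (1 <= k.+1%:R :> R)%R by rewrite ler1n.
move: IH; rewrite [in X in _ -> _ -> _ -> X]mulrS; lra.
Qed.

Lemma increasing_trivIset : trivIset setT (block u t).
Proof.
apply: ltn_trivIset => j k kj; rewrite -subset0 => x [] /=.
rewrite /block /= !in_itv/= => /andP[_ xt] /andP[tx _].
have := lt_le_trans xt (increasing_t_le kj).
by rewrite ltNge tx.
Qed.

(** The mirror image of [decreasing_sum]: here [k] is the last block beginning
    before [x], and it is the masses of the earlier blocks that telescope to
    at most [u k * (eps k * t k)]. *)
Lemma increasing_sum x : (0 < x)%R -> exists k, forall n,
  (\sum_(0 <= j < n) u j * block_part t j x <= u k * Num.min x (t k))%R.
Proof.
move=> x0.
have exm : exists m, (x < eps m * t m)%R.
  exists (Num.bound x).+1; apply: lt_le_trans (t_step _).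
  apply: lt_le_trans (increasing_t_ge _).
  rewrite (lt_trans (archi_boundP _)) ?ltW//.
  by rewrite ltr_nat.
have sum_le k : (\sum_(0 <= j < k) u j * block_part t j x <=
    eps k * (u k * t k))%R.
  elim: k => [|k IH].
    by rewrite big_geq// !mulr_ge0 ?ltW// eps_gt0.
  rewrite big_nat_recr//=; apply: le_trans (c_step k).
  apply: (@le_trans _ _ (eps k * (u k * t k) + u k * (t k - eps k * t k)))%R.
    by rewrite lerD// ler_pM2l// block_part_le.
  by rewrite mulrBr [in leLHS]mulrCA addrC subrK.
case: (ex_minnP exm) => m xm mmin; exists m.-1 => n.
have out j : (m <= j)%N -> block_part t j x = 0%R.
  move=> mj; apply: block_part_out; apply: le_trans (ltW xm) _.
  move: mj; rewrite leq_eqVlt => /predU1P[->//|/increasing_t_le].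
  by apply: le_trans; rewrite ler_piMl ?ltW// eps_lt1.
have part0 j : (0 <= u j * block_part t j x)%R.
  by rewrite mulr_ge0 ?block_part_ge0 ?ltW.
apply: (@le_trans _ _ (\sum_(0 <= j < m) u j * block_part t j x)%R).
  have [nm|mn] := leqP n m.
    by rewrite [leRHS](big_cat_nat (leq0n n) nm)/= lerDl sumr_ge0.
  rewrite (big_cat_nat (leq0n m) (ltnW mn))/= gerDl.
  rewrite big_nat_cond big1// => j /andP[/andP[mj _] _].
  by rewrite out ?mulr0.
case: m xm mmin out => [|k] xm mmin out.
  by rewrite big_geq// mulr_ge0 ?ltW// lt_min x0 t0.
rewrite big_nat_recr//= block_part_in//; last first.
  by rewrite leNgt; apply/negP => /mmin; rewrite ltnn.
by rewrite mulrBr addrCA gerDl subr_le0 mulrCA.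
Qed.

End increasing.
End block_sequences.

Section block_supply.
Context {R : realType}.

(** A block of height [u] and right endpoint [t] with a small modular, whose
    modular becomes large after a dilation by the factor [1 + e].  The
    constant 3 exceeds twice the radius 1 of the modular ball, since only half
    of the block is used in [cesaro_modular_block_gt1]. *)
Definition good_block (I : base_interval) (phi : R -> \bar R) (e u t : R) :=
  [/\ (0 < u)%R, (0 < t)%R, block_modular phi I u (u * t)%R <= e%:E &
      3 < t%:E * phi ((1 + e) * u)%R].

(** Blocks of arbitrarily small length and mass are chosen one after another,
    each negligible with respect to the preceding one; they accumulate at the
    origin, so this works on both intervals. *)
Lemma small_blocks_copy (I : base_interval) (phi : R -> \bar R) :
  orlicz_function phi ->
  (forall e d : R, (0 < e)%R -> (0 < d)%R -> exists u t : R,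
    [/\ good_block I phi e u t, (t <= d)%R & (u * t <= d)%R]) ->
  contains_order_isometric_copy_of_linfty I (Ces I phi) (Ces_norm I phi).
Proof.
move=> hphi supply.
have /choice[F hF] : forall kd : nat * R, exists p : R * R, (0 < kd.2)%R ->
    [/\ good_block I phi (eps kd.1) p.1 p.2, (p.2 <= kd.2)%R
      & (p.1 * p.2 <= kd.2)%R].
  move=> [k d]; have [d0|d0] := ltP 0%R d; last first.
    by exists (0, 0)%R.
  by have [u [t h]] := supply _ _ (eps_gt0 k) d0; exists (u, t).
pose next k (p : R * R) := F (k.+1, eps k * Num.min p.2 (p.1 * p.2))%R.
pose s := fix s k := if k is j.+1 then next j (s j) else F (0%N, 1%R).
pose u k := (s k).1; pose t k := (s k).2.
have step k : good_block I phi (eps k) (u k) (t k) ->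
    [/\ (t k.+1 <= eps k * t k)%R, (u k.+1 * t k.+1 <= eps k * (u k * t k))%R
      & good_block I phi (eps k.+1) (u k.+1) (t k.+1)].
  case=> uk tk _ _.
  have [|gb h1 h2] := hF (k.+1, eps k * Num.min (t k) (u k * t k))%R.
    by rewrite /= mulr_gt0 ?eps_gt0// lt_min tk mulr_gt0.
  split; last exact: gb.
    by apply: le_trans h1 _; rewrite ler_pM2l ?eps_gt0//= ge_min lexx.
  by apply: le_trans h2 _; rewrite ler_pM2l ?eps_gt0//= ge_min lexx orbT.
have [gb0 t01 _] := hF (0%N, 1%R) ltr01.
have gb k : good_block I phi (eps k) (u k) (t k).
  by elim: k => [|k /step[_ _]]; [exact: gb0|].
have u0 k : (0 < u k)%R by case: (gb k).
have t0 k : (0 < t k)%R by case: (gb k).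
have ts k : (t k.+1 <= eps k * t k)%R by case: (step k (gb k)).
have cs k : (u k.+1 * t k.+1 <= eps k * (u k * t k))%R.
  by case: (step k (gb k)).
apply: (@blocks_copy _ I phi u t hphi u0 t0).
- exact: decreasing_trivIset.
- move=> k x; rewrite /block /= in_itv/= => /andP[xt tx].
  have x0 : (0 <= x)%R.
    by apply: le_trans xt; rewrite mulr_ge0 ?(ltW (t0 k))// ltW// eps_gt0.
  have x1 : (x <= 1)%R.
    by apply: le_trans (ltW tx) _; exact: decreasing_t_le1.
  by case: (I); rewrite /= in_itv/= x0.
- exact: decreasing_sum.
- by move=> k; case: (gb k).
- by move=> k; case: (gb k).
Qed.

(** Blocks of arbitrarily large length and mass escape to infinity, which
    is possible on the half line only. *)
Lemma large_blocks_copy (phi : R -> \bar R) :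
  orlicz_function phi ->
  (forall e d : R, (0 < e)%R -> (0 < d)%R -> exists u t : R,
    [/\ good_block half_line phi e u t, (d <= t)%R & (d <= u * t)%R]) ->
  contains_order_isometric_copy_of_linfty half_line
    (Ces half_line phi) (Ces_norm half_line phi).
Proof.
move=> hphi supply; set I := half_line.
have /choice[F hF] : forall kd : nat * R, exists p : R * R, (0 < kd.2)%R ->
    [/\ good_block I phi (eps kd.1) p.1 p.2, (kd.2 <= p.2)%R
      & (kd.2 <= p.1 * p.2)%R].
  move=> [k d]; have [d0|d0] := ltP 0%R d; last first.
    by exists (0, 0)%R.
  by have [u [t h]] := supply _ _ (eps_gt0 k) d0; exists (u, t).
pose next k (p : R * R) :=
  F (k.+1, (eps k.+1)^-1 * Num.max p.2 (p.1 * p.2))%R.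
pose s := fix s k := if k is j.+1 then next j (s j) else F (0%N, 1%R).
pose u k := (s k).1; pose t k := (s k).2.
have step k : good_block I phi (eps k) (u k) (t k) ->
    [/\ (t k <= eps k.+1 * t k.+1)%R,
       (u k * t k <= eps k.+1 * (u k.+1 * t k.+1))%R
      & good_block I phi (eps k.+1) (u k.+1) (t k.+1)].
  case=> uk tk _ _.
  have e0 := eps_gt0 (R := R) k.+1.
  have [|gb h1 h2] := hF (k.+1, (eps k.+1)^-1 * Num.max (t k) (u k * t k))%R.
    by rewrite /= mulr_gt0 ?invr_gt0// lt_max tk.
  split; last exact: gb.
    rewrite -ler_pdivrMl//; apply: le_trans h1.
    by rewrite ler_pM2l ?invr_gt0//= le_max lexx.
  rewrite -ler_pdivrMl//; apply: le_trans h2.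
  by rewrite ler_pM2l ?invr_gt0//= le_max lexx orbT.
have [gb0 t01 _] := hF (0%N, 1%R) ltr01.
have gb k : good_block I phi (eps k) (u k) (t k).
  by elim: k => [|k /step[_ _]]; [exact: gb0|].
have u0 k : (0 < u k)%R by case: (gb k).
have t0 k : (0 < t k)%R by case: (gb k).
have ts k : (t k <= eps k.+1 * t k.+1)%R by case: (step k (gb k)).
have cs k : (u k * t k <= eps k.+1 * (u k.+1 * t k.+1))%R.
  by case: (step k (gb k)).
apply: (@blocks_copy _ I phi u t hphi u0 t0).
- exact: increasing_trivIset.
- move=> k x; rewrite /block /= !in_itv/= => /andP[xt tx]; rewrite andbT.
  by apply: le_trans xt; rewrite mulr_ge0 ?(ltW (t0 k))// ltW// eps_gt0.
- exact: increasing_sum.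
- by move=> k; case: (gb k).
- by move=> k; case: (gb k).
Qed.

End block_supply.

(** * The modular of a single block *)

Section block_modular_estimates.
Context {R : realType} (phi : R -> \bar R) (hphi : orlicz_function phi).
Local Notation LR := (lebesgueTypeR R).

Lemma orlicz_fineK (w : R) : (0 <= w)%R -> phi w < +oo ->
  phi w = (fine (phi w))%:E.
Proof. by move=> w0 wo; rewrite fineK// ge0_fin_numE// (orlicz_ge0 hphi). Qed.

Lemma fine_orlicz_ge0 (w : R) : (0 <= w)%R -> (0 <= fine (phi w))%R.
Proof. by move=> w0; rewrite fine_ge0// (orlicz_ge0 hphi). Qed.

Lemma orlicz_block_mean_ge0 u c x : (0 <= u)%R -> (0 <= c)%R ->
  0 <= phi (block_mean u c x).
Proof. by move=> u0 c0; apply: (orlicz_ge0 hphi); exact: block_mean_ge0. Qed.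

Lemma measurable_scaled_indic (D : set LR) (a b : R) :
  measurable D -> measurable_fun D
    (fun x : LR => a%:E * (\1_(`[0%R, b[%classic : set LR) x)%:E).
Proof.
move=> mD; apply: emeasurable_funM; first exact: measurable_cst.
apply/measurable_EFinP; apply: measurable_indic.
exact: measurable_Lebesgue_itv.
Qed.

Lemma integral_scaled_indic_le (I : base_interval) (a b : R) :
  (0 <= a)%R -> (0 <= b)%R ->
  \int[leb_mu]_(x in (base_set I : set LR))
    (a%:E * (\1_(`[0%R, b[%classic : set LR) x)%:E) <= (a * b)%:E.
Proof.
move=> a0 b0.
have mJ : measurable (`[0%R, b[%classic : set LR) := measurable_Lebesgue_itv _.
have mI := measurable_base_set (R := R) I.
rewrite ge0_integralZl; [|by []| |by []|by rewrite lee_fin]; last first.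
  by apply/measurable_EFinP; apply: measurable_indic; exact: mJ.
rewrite integral_indic// EFinM; apply: lee_wpmul2l; first by rewrite lee_fin.
apply: (@le_trans _ _ (leb_mu (`[0%R, b[%classic : set LR))).
  apply: le_measure; rewrite ?inE; [exact: measurableI|exact: mJ|].
  exact: subIsetl.
rewrite leb_mu_itv /= lte_fin; case: ifPn => _; last by rewrite lee_fin.
by rewrite -EFinB subr0.
Qed.

(** Beyond a short initial interval, [block_mean w c'] is a small multiple of
    [block_mean u c] when [c'] is small, so that convexity bounds its modular
    by the same small multiple of [block_modular I u c]. *)
Lemma block_modular_small (I : base_interval) (u c w e : R) :
  (0 < u)%R -> (0 < c)%R -> block_modular phi I u c < +oo ->
  (0 <= w)%R -> phi w < +oo -> (0 < e)%R ->
  exists2 d : R, (0 < d)%R & forall c' : R, (0 <= c' <= d)%R ->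
    block_modular phi I w c' <= e%:E.
Proof.
move=> u0 c0 uc w0 wo e0.
have mI := measurable_base_set (R := R) I.
pose W := fine (phi w); have W0 : (0 <= W)%R := fine_orlicz_ge0 w0.
have M0 : 0 <= block_modular phi I u c.
  by apply: integral_ge0 => x _; apply: orlicz_block_mean_ge0; exact: ltW.
pose M := fine (block_modular phi I u c).
have ME : block_modular phi I u c = M%:E by rewrite fineK// ge0_fin_numE.
have {}M0 : (0 <= M)%R by rewrite -lee_fin -ME.
(* On [0, h[ the integrand is at most W, and k is the small multiple beyond;
   each of the two parts contributes at most e / 2. *)
pose h := (e / (2 * (W + 1)))%R.
have h0 : (0 < h)%R by rewrite divr_gt0// mulr_gt0// ltr_wpDl.
pose k := Num.min 1%R (e / (2 * (M + 1)))%R.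
have k0 : (0 < k)%R by rewrite lt_min ltr01 divr_gt0// mulr_gt0// ltr_wpDl.
have k1 : (k <= 1)%R by rewrite ge_min lexx.
have kM : (k * M <= e / 2)%R.
  apply: (@le_trans _ _ (e / (2 * (M + 1)) * M)%R).
    by rewrite ler_wpM2r// ge_min lexx orbT.
  rewrite mulrAC ler_pdivrMr; first lra.
  by rewrite mulr_gt0// ltr_wpDl.
have hW : (W * h <= e / 2)%R.
  rewrite /h mulrA ler_pdivrMr; first lra.
  by rewrite mulr_gt0// ltr_wpDl.
exists (k * Num.min (h * u) c)%R.
  by rewrite mulr_gt0// lt_min mulr_gt0.
move=> c' /andP[c'0 c'd].
pose g1 (x : LR) : \bar R := W%:E * (\1_(`[0%R, h[%classic : set LR) x)%:E.
pose g2 (x : LR) : \bar R := k%:E * phi (block_mean u c x).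
have g10 x : 0 <= g1 x by rewrite mule_ge0// lee_fin.
have p0 x : 0 <= phi (block_mean u c x).
  by apply: orlicz_block_mean_ge0; exact: ltW.
have g20 x : 0 <= g2 x by rewrite mule_ge0// lee_fin ltW.
have mp : measurable_fun (base_set I : set LR)
    (fun x : LR => phi (block_mean u c x)).
  by apply: measurable_orlicz_block_mean => //; exact: ltW.
apply: (@le_trans _ _
    (\int[leb_mu]_(x in (base_set I : set LR)) (g1 x + g2 x))).
  apply: ge0_le_integral_any => x Ix; first exact: orlicz_block_mean_ge0.
  have x0 := base_set_ge0 Ix.
  have [xh|hx] := ltP x h.
    rewrite -[leLHS]adde0; apply: leeD; last exact: g20.
    rewrite /g1 indicE mem_set /= ?in_itv/= ?x0// mule1 -orlicz_fineK//.
    by apply: orlicz_mono => //; rewrite block_mean_le block_mean_ge0.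
  rewrite -[leLHS]add0e; apply: leeD; first exact: g10.
  have {}x0 : (0 < x)%R := lt_le_trans h0 hx.
  apply: (@le_trans _ _ (phi (k * block_mean u c x)%R)); last first.
    by apply: orlicz_scale => //; rewrite ?block_mean_ge0 ?(ltW k0)// ltW.
  apply: orlicz_mono => //; rewrite block_mean_ge0//=.
  apply: (le_trans (block_mean_div _ _ x0)).
  rewrite /block_mean (lt_geF x0) minr_pMr ?(ltW k0)// le_min.
  apply/andP; split.
    rewrite ler_pdivrMr//; apply: (le_trans c'd).
    rewrite -[leRHS]mulrA ler_pM2l// ge_min; apply/orP; left.
    by rewrite mulrC ler_pM2l.
  rewrite mulrA ler_pM2r ?invr_gt0//; apply: (le_trans c'd).
  by rewrite ler_pM2l// ge_min lexx orbT.
have mg1 : measurable_fun (base_set I : set LR) g1.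
  exact: measurable_scaled_indic.
have mg2 : measurable_fun (base_set I : set LR) g2.
  by apply: emeasurable_funM; [exact: measurable_cst|exact: mp].
rewrite (ge0_integralD leb_mu mI (fun x _ => g10 x) mg1 (fun x _ => g20 x) mg2).
rewrite (splitr e) EFinD; apply: leeD.
  apply: le_trans (integral_scaled_indic_le I W0 (ltW h0)) _.
  by rewrite lee_fin.
rewrite (ge0_integralZl leb_mu mI mp) ?lee_fin ?(ltW k0)//.
by rewrite [X in _ * X]ME -EFinM lee_fin.
Qed.

(** Since [q / 2] corresponds to [2 ^ - p] with [p > 1] when [q < 1], this
    says at dyadic ratios that [phi v] is at most a constant times
    [(v / u) ^ p * phi u] whenever [w <= v <= u]. *)
Definition dyadic_decay (K q w : R) := forall (u : R) (j : nat),
  (0 < u)%R -> phi u < +oo -> (w <= u / 2 ^+ j)%R ->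
  phi (u / 2 ^+ j)%R <= (K * (q / 2) ^+ j)%:E * phi u.

(** A substitute for Hardy's inequality.  For [x] between [2 ^ j * t] and
    [2 ^ j.+1 * t] the mean of the block is at most [u / 2 ^ j]; there
    [dyadic_decay] gives a factor [(q / 2) ^ j], which beats the length
    [2 ^ j.+1 * t] of the interval, so the contributions form a convergent
    geometric series.  Means below the threshold [w] are left to the last
    term. *)
Lemma block_modular_dyadic (I : base_interval) (K q w u t : R) :
  (0 <= K)%R -> (0 < q < 1)%R -> (0 <= w)%R -> dyadic_decay K q w ->
  (0 < u)%R -> (0 < t)%R -> phi u < +oo -> (w <= u)%R ->
  block_modular phi I u (u * t)%R <=
  (2 * K / (1 - q) * t * fine (phi u))%:E + block_modular phi I w (u * t)%R.
Proof.
move=> K0 /andP[q0 q1] w0 hK u0 t0 uo wu.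
have mI := measurable_base_set (R := R) I.
pose P := fine (phi u); have P0 : (0 <= P)%R := fine_orlicz_ge0 (ltW u0).
have ut0 : (0 < u * t)%R by rewrite mulr_gt0.
pose a j := (K * (q / 2) ^+ j * P)%R.
have a0 j : (0 <= a j)%R by rewrite !mulr_ge0// exprn_ge0// divr_ge0// ltW.
pose b j := (2 ^+ j.+1 * t)%R.
have b0 j : (0 < b j)%R by rewrite mulr_gt0// exprn_gt0.
pose g j (x : LR) : \bar R :=
  (a j)%:E * (\1_(`[0%R, b j[%classic : set LR) x)%:E.
pose g2 (x : LR) : \bar R := phi (block_mean w (u * t) x).
have g0 j x : 0 <= g j x by rewrite mule_ge0// lee_fin.
have g20 x : 0 <= g2 x by apply: orlicz_block_mean_ge0; rewrite ?(ltW ut0).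
have mg j : measurable_fun (base_set I : set LR) (g j).
  exact: measurable_scaled_indic.
have mg2 : measurable_fun (base_set I : set LR) g2.
  by apply: measurable_orlicz_block_mean => //; exact: ltW.
have s0 x : 0 <= \sum_(j <oo) g j x.
  by apply: nneseries_ge0 => j _ _; exact: g0.
apply: (@le_trans _ _ (\int[leb_mu]_(x in (base_set I : set LR))
    ((\sum_(j <oo) g j x) + g2 x))).
  apply: ge0_le_integral_any => x Ix.
    by apply: orlicz_block_mean_ge0; exact: ltW.
  have x0 := base_set_ge0 Ix.
  have exj : exists j, (x < b j)%R.
    exists (Num.bound (x / t)); rewrite -ltr_pdivrMr//.
    rewrite (lt_le_trans (archi_boundP _)) ?divr_ge0 ?(ltW t0)//.
    rewrite -natrX ler_nat (leq_trans (ltnW (ltn_expl _ (isT : 1 < 2)%N)))//.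
    by rewrite leq_exp2l.
  (* The least such j gives x >= 2 ^ j * t unless j = 0, and in both cases the
     mean is at most u / 2 ^ j. *)
  case: (ex_minnP exj) => j xj jmin.
  have xuj : (block_mean u (u * t) x <= u / 2 ^+ j)%R.
    case: j xj jmin => [|j] xj jmin; first by rewrite expr0 divr1 block_mean_le.
    have bx : (b j <= x)%R.
      by rewrite leNgt; apply/negP => /jmin; rewrite ltnn.
    have {}x0 : (0 < x)%R := lt_le_trans (b0 j) bx.
    apply: (le_trans (block_mean_div _ _ x0)).
    rewrite ler_pdivrMr// -mulrA ler_pM2l//.
    by rewrite mulrC ler_pdivlMr ?exprn_gt0// mulrC.
  have [wuj|ujw] := leP w (u / 2 ^+ j)%R.
    rewrite -[leLHS]adde0; apply: leeD; last exact: g20.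
    apply: (@le_trans _ _ (g j x)); last first.
      apply: le_trans (nneseries_lim_ge j.+1 _) => //.
      rewrite big_nat_recr//=; apply: leeDr.
      by apply: sume_ge0 => i _; exact: g0.
    rewrite /g indicE mem_set /= ?in_itv/= ?x0// mule1 /a EFinM.
    rewrite -orlicz_fineK ?(ltW u0)//.
    apply: le_trans _ (hK u j u0 uo wuj).
    by apply: orlicz_mono => //; rewrite xuj block_mean_ge0// ltW.
  rewrite -[leLHS]add0e; apply: leeD; first exact: s0.
  apply: orlicz_mono => //; rewrite block_mean_ge0 ?(ltW u0) ?(ltW ut0)//=.
  have xw := le_trans xuj (ltW ujw).
  rewrite [leRHS]/block_mean; case: (leP x 0%R) => [//|{}x0].
  by rewrite le_min xw block_mean_div.
have ms : measurable_fun (base_set I : set LR)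
    (fun x : LR => \sum_(j <oo) g j x).
  by apply: ge0_emeasurable_sum => // j x _ _; exact: g0.
rewrite (ge0_integralD leb_mu mI (fun x _ => s0 x) ms (fun x _ => g20 x) mg2).
apply: leeD; last by [].
rewrite integral_nneseries//.
apply: (@le_trans _ _ (\sum_(j <oo) (2 * K * t * P * q ^+ j)%:E)).
  apply: lee_nneseries => [j _ _|j _].
    by apply: integral_ge0 => x _; exact: g0.
  apply: le_trans (integral_scaled_indic_le I (a0 j) (ltW (b0 j))) _.
  rewrite lee_fin /a /b exprMn exprVn exprS le_eqVlt; apply/orP; left.
  by apply/eqP; field; rewrite expf_neq0.
apply: le_trans (geometric_nneseries_le _ _) _.
- by rewrite !mulr_ge0// ltW.
- by rewrite (ltW q0).
by rewrite lee_fin le_eqVlt; apply/orP; left; apply/eqP; rewrite /P; ring.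
Qed.

End block_modular_estimates.

(** * Geometric decay from convexity of the root *)

Section root_convexity.
Context {R : realType}.

Lemma convex_function_le (D : set R) (gamma : R -> R) :
  convex_function (D : set R^o) gamma ->
  forall x y s : R, D x -> D y -> (0 <= s <= 1)%R ->
  (gamma (s * x + (1 - s) * y) <= s * gamma x + (1 - s) * gamma y)%R.
Proof.
move=> cvx x y s Dx Dy /andP[s0 s1].
by have := cvx (Itv01 s0 s1) x y; rewrite !inE; apply.
Qed.

(** A convex function lies below its chord over [[u0, u]].  The contribution
    of [gamma u0] to the chord is at most half of [gamma v] and is absorbed,
    which leaves the homogeneous bound; the weight [(v - u0) / (u - u0)] of
    [gamma u] is at most [v / u]. *)
Lemma convex_chord (D : set R) (gamma : R -> R) (u0 v u : R) :
  convex_function (D : set R^o) gamma -> D u0 -> D u ->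
  (0 <= u0)%R -> (u0 <= v <= u)%R -> (0 < u)%R ->
  (0 <= gamma u0)%R -> (0 <= gamma u)%R ->
  (2 * gamma u0 <= gamma v)%R ->
  (gamma v <= 2 * (v / u) * gamma u)%R.
Proof.
move=> cvx Du0 Du u00 /andP[u0v vu] u_gt0 g0 gu gv.
have [uu0|u0u] := leP u u0.
  have -> : v = u by apply/le_anti; rewrite vu (le_trans uu0).
  by rewrite divff ?lt0r_neq0// mulr1 mulr_natl mulr2n lerDl.
have d0 : (0 < u - u0)%R by rewrite subr_gt0.
pose s := ((v - u0) / (u - u0))%R.
have s01 : (0 <= s <= 1)%R.
  by rewrite /s divr_ge0 ?subr_ge0 ?(ltW u0u)//= ler_pdivrMr// mul1r lerD2r.
have := convex_function_le cvx Du Du0 s01.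
have -> : (s * u + (1 - s) * u0 = v)%R.
  by rewrite /s; field; rewrite lt0r_neq0.
have sv : (s <= v / u)%R.
  rewrite /s ler_pdivrMr// mulrAC ler_pdivlMr//.
  rewrite mulrBl mulrBr lerD2l lerN2 (mulrC v) ler_wpM2l//.
have : (s * gamma u <= (v / u) * gamma u)%R by rewrite ler_wpM2r.
have : (0 <= s * gamma u0)%R by rewrite mulr_ge0//; case/andP: s01.
by rewrite -mulrA; lra.
Qed.

Lemma powR_half (p : R) j :
  (((2 ^+ j)^-1 : R) `^ p = ((2^-1 : R) `^ p) ^+ j)%R.
Proof.
elim: j => [|j IH]; first by rewrite !expr0 invr1 powR1.
by rewrite !exprS invfM powRM ?invr_ge0 ?exprn_ge0// IH.
Qed.

(** [convex_chord] passes from [gamma] to the root of [phi] with the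
    constant [2 * B / A]; raising to the power [p] gives the ratio
    [2 ^ - p = q / 2], and [q < 1] precisely because [p > 1]. *)
Lemma root_convex_dyadic_decay (phi : R -> \bar R) (p u0 w : R) :
  orlicz_function phi -> (1 < p)%R -> (0 <= u0)%R -> (u0 <= w)%R ->
  (forall v, (0 <= v)%R -> v%:E < orlicz_b phi -> phi v < +oo) ->
  (forall v, (0 < v)%R -> phi v < +oo -> v%:E < orlicz_b phi) ->
  u0%:E < orlicz_b phi ->
  forall (A B : R) (gamma : R -> R), (0 < A)%R -> (0 < B)%R ->
  convex_function
    ([set u | (u0 <= u)%R /\ u%:E < orlicz_b phi] : set R^o) gamma ->
  (forall u, (u0 <= u)%R -> u%:E < orlicz_b phi ->
    (A * gamma u)%:E <= poweR (phi u) p^-1 <= (B * gamma u)%:E) ->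
  (forall v, (w <= v)%R -> v%:E < orlicz_b phi ->
    (2 * gamma u0 <= gamma v)%R) ->
  exists K q : R, [/\ (0 <= K)%R, (0 < q < 1)%R & dyadic_decay phi K q w].
Proof.
move=> hphi p1 u00 u0w finb bfin u0b A B gamma A0 B0 cvx hg hw.
have p0 : (0 < p)%R by apply: lt_trans p1.
have pow u : (u0 <= u)%R -> u%:E < orlicz_b phi ->
    (A * gamma u <= fine (phi u) `^ p^-1 <= B * gamma u)%R.
  move=> u0u ub; have := hg u u0u ub.
  have u_ge0 := le_trans u00 u0u.
  by rewrite (orlicz_fineK hphi u_ge0 (finb u u_ge0 ub)) poweR_EFin !lee_fin.
have gge0 u : (u0 <= u)%R -> u%:E < orlicz_b phi -> (0 <= gamma u)%R.
  move=> u0u ub; rewrite -(pmulr_rge0 _ B0).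
  by have /andP[_] := pow u u0u ub; apply: le_trans; exact: powR_ge0.
exists ((2 * B / A) `^ p)%R, (2 * 2^-1 `^ p)%R; split.
- exact: powR_ge0.
- rewrite mulr_gt0 ?powR_gt0//=.
  have half1 : (2^-1 `^ (p - 1) < 1 :> R)%R.
    apply: (@lt_le_trans _ _ (1 `^ (p - 1))%R); last by rewrite powR1.
    apply: gt0_ltr_powR.
    - by rewrite subr_gt0.
    - by rewrite nnegrE invr_ge0.
    - by rewrite nnegrE.
    - by rewrite invf_lt1 ?ltr1n.
  have -> : (2^-1 `^ p = 2^-1 `^ (p - 1) * 2^-1 :> R)%R.
    have := @powRD R 2^-1 (p - 1) 1; rewrite subrK powRr1 ?invr_ge0//.
    by apply; apply/implyP => _; rewrite invr_neq0.
  by rewrite mulrCA divff ?mulr1.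
move=> u j u_gt0 uo wuj.
set v := (u / 2 ^+ j)%R.
have vu : (v <= u)%R.
  rewrite ler_pdivrMr ?exprn_gt0// ler_peMr ?(ltW u_gt0)//.
  by rewrite exprn_ege1// ler1n.
have ub := bfin u u_gt0 uo.
have vb : v%:E < orlicz_b phi by apply: le_lt_trans ub; rewrite lee_fin.
have u0v := le_trans u0w wuj.
have u0u := le_trans u0v vu.
have v0 := le_trans u00 u0v.
have vo := finb v v0 vb.
have chord : (gamma v <= 2 * (v / u) * gamma u)%R.
  apply: (@convex_chord _ gamma u0 v u cvx) => //; first by rewrite u0v.
  - exact: gge0.
  - exact: gge0.
  - exact: hw.
rewrite (orlicz_fineK hphi v0 vo) (orlicz_fineK hphi (ltW u_gt0) uo).
rewrite -EFinM lee_fin; set P := fine (phi u); set Q := fine (phi v).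
have P0 : (0 <= P)%R := fine_orlicz_ge0 hphi (ltW u_gt0).
have Q0 : (0 <= Q)%R := fine_orlicz_ge0 hphi v0.
have root : (Q `^ p^-1 <= 2 * B / A * (2 ^+ j)^-1 * P `^ p^-1)%R.
  have /andP[_ h1] := pow v u0v vb; have /andP[h2 _] := pow u u0u ub.
  apply: (le_trans h1); apply: (@le_trans _ _ (B * (2 * (v / u) * gamma u))%R).
    by rewrite ler_pM2l.
  have -> : (v / u = (2 ^+ j)^-1)%R.
    by rewrite /v mulrAC divff ?mul1r// lt0r_neq0.
  have -> : (B * (2 * (2 ^+ j)^-1 * gamma u) =
      2 * B / A * (2 ^+ j)^-1 * (A * gamma u))%R.
    by field; rewrite expf_neq0//= lt0r_neq0.
  by rewrite ler_wpM2l// !mulr_ge0 ?invr_ge0 ?exprn_ge0// ltW.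
have := ge0_ler_powR (ltW p0) _ _ root; rewrite !nnegrE => h.
have {}h := h (powR_ge0 _ _).
rewrite -powRrM mulVf ?lt0r_neq0// powRr1// in h.
apply: le_trans (h _) _.
  by rewrite !mulr_ge0 ?powR_ge0 ?invr_ge0 ?exprn_ge0// ltW.
rewrite powRM ?powR_ge0//; last first.
  by rewrite !mulr_ge0 ?invr_ge0 ?exprn_ge0// ltW.
rewrite powRM ?invr_ge0 ?exprn_ge0//; last first.
  by rewrite !mulr_ge0 ?invr_ge0 ?exprn_ge0// ltW.
rewrite -powRrM mulVf ?lt0r_neq0// powRr1// powR_half.
by have -> : (2 * 2^-1 `^ p / 2 = 2^-1 `^ p :> R)%R by field.
Qed.

End root_convexity.

(** * The finiteness threshold of an Orlicz function *)

Section finiteness_threshold.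
Context {R : realType} (phi : R -> \bar R) (hphi : orlicz_function phi).

Lemma orlicz_lt_b_fin u : (0 <= u)%R -> u%:E < orlicz_b phi -> phi u < +oo.
Proof.
move=> u0 /ereal_sup_gt[_ [v [v0 vo] <-]]; rewrite lte_fin => uv.
by apply: le_lt_trans vo; apply: orlicz_mono => //; rewrite u0 ltW.
Qed.

Lemma orlicz_fin_le_b u : (0 < u)%R -> phi u < +oo -> u%:E <= orlicz_b phi.
Proof. by move=> u0 uo; apply: ereal_sup_ubound; exists u. Qed.

Lemma orlicz_fin_point : exists2 u, (0 < u)%R & phi u < +oo.
Proof.
by have [u u0 uo] := orlicz_not_identically_oo hphi; exists u; rewrite ?ltey.
Qed.

Lemma orlicz_b_gt0 : 0 < orlicz_b phi.
Proof.
have [u u0 uo] := orlicz_fin_point.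
by apply: lt_le_trans (orlicz_fin_le_b u0 uo); rewrite lte_fin.
Qed.

(** Equality [u = orlicz_b phi] would make [phi] finite at its threshold. *)
Lemma orlicz_fin_lt_b : orlicz_at_b phi = +oo ->
  forall u, (0 < u)%R -> phi u < +oo -> u%:E < orlicz_b phi.
Proof.
move=> hb u u0 uo; rewrite lt_neqAle orlicz_fin_le_b// andbT.
by apply/eqP => ub; move: hb uo; rewrite /orlicz_at_b -ub => ->; rewrite ltxx.
Qed.

Lemma orlicz_cvgy : phi u @[u --> +oo%R] --> +oo.
Proof.
have [v v0 vn0] := orlicz_not_identically_0 hphi.
have pv : 0 < phi v by rewrite lt0e vn0 (orlicz_ge0 hphi)// ltW.
have [k k0 kv] : exists2 k : R, (0 < k)%R & k%:E <= phi v.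
  case: (phi v) pv => [r||]//; last by exists 1%R => //; rewrite leey.
  by rewrite lte_fin => r0; exists r.
apply/cvgeyPge => A; near=> u.
have uv : (v <= u)%R by near: u; apply: nbhs_pinfty_ge; exact: num_real.
have u0 : (0 < u)%R by apply: lt_le_trans uv.
have Au : (A * v / k <= u)%R by near: u; apply: nbhs_pinfty_ge; exact: num_real.
have := @orlicz_ratio R phi hphi v u; rewrite ltW//= => /(_ uv u0) pvu.
have := le_trans kv pvu; case: (phi u) => [r||]; last 2 first.
- by rewrite leey.
- by rewrite gt0_muleNy ?lte_fin ?divr_gt0// leeNy_eq.
rewrite -EFinM !lee_fin mulrAC ler_pdivlMr// => h.
move: Au; rewrite ler_pdivrMr// mulrC [(u * k)%R]mulrC => Au.
by rewrite -(ler_pM2l v0) (le_trans Au).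
Unshelve. all: by end_near. Qed.

Lemma orlicz_at_b_fin : orlicz_at_b phi != +oo ->
  exists b : R, [/\ (0 < b)%R, orlicz_b phi = b%:E & phi b < +oo].
Proof.
rewrite /orlicz_at_b; have := orlicz_b_gt0.
case: (orlicz_b phi) => [b||]//; last first.
  by move=> _; rewrite (cvg_lim _ orlicz_cvgy)// eqxx.
by rewrite lte_fin => b0 bo; exists b; rewrite ltey.
Qed.

(** If the threshold is finite, left continuity makes [phi] blow up there;
    otherwise [phi] tends to infinity. *)
Lemma orlicz_unbounded : orlicz_at_b phi = +oo -> forall M : R,
  exists u, [/\ (0 < u)%R, u%:E < orlicz_b phi & M%:E < phi u].
Proof.
move=> + M; rewrite /orlicz_at_b; have := orlicz_b_gt0.
case Eb : (orlicz_b phi) => [b||]//; last first.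
  move=> _ _; have /cvgeyPgt/(_ M) := orlicz_cvgy => hM.
  near (pinfty_nbhs R) => u; exists u; split; last by near: u.
    by near: u; apply: nbhs_pinfty_gt; exact: num_real.
  by rewrite ltry.
rewrite lte_fin => b0 bo.
have := orlicz_left_continuous hphi b0; rewrite bo => /cvgeyPgt/(_ M) hM.
near (b^'-)%classic => u; exists u; split; last by near: u.
  by near: u; exact: nbhs_left_gt.
by rewrite lte_fin; near: u; exact: nbhs_left_lt.
Unshelve. all: by end_near. Qed.

Lemma root_all_large (p : R) : orlicz_at_b phi = +oo ->
  root_equiv_convex_all phi p -> root_equiv_convex_large phi p.
Proof.
move=> hb [A [B [gamma [A0 B0 cvx hg]]]].
have [u [u0 ub pu]] := orlicz_unbounded hb 0%R.
exists u; split=> //; exists A, B, gamma; split=> //; last first.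
  by move=> v [uv vb]; apply: hg; split=> //; rewrite (le_trans (ltW u0)).
move=> s x y; rewrite !inE => -[ux xb] [uy yb]; apply: cvx; rewrite inE.
  by split=> //; rewrite (le_trans (ltW u0)).
by split=> //; rewrite (le_trans (ltW u0)).
Qed.

(** The threshold [w] is taken so large that [gamma] has at least doubled with
    respect to its value at [u0]; this is possible because [phi], hence its
    root, is unbounded below [orlicz_b phi]. *)
Lemma root_large_dyadic_decay (p : R) : (1 < p)%R ->
  orlicz_at_b phi = +oo -> root_equiv_convex_large phi p ->
  exists w K q : R, [/\ (0 < w)%R, phi w < +oo, 0 < phi w,
    (0 <= K)%R /\ (0 < q < 1)%R & dyadic_decay phi K q w].
Proof.
move=> p1 hb [u0 [u00 u0b pu0 [A [B [gamma [A0 B0 cvx hg]]]]]].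
have p0 : (0 < p)%R by apply: lt_trans p1.
have fu0 := orlicz_lt_b_fin (ltW u00) u0b.
pose M := Num.max (fine (phi u0)) ((2 * (B * gamma u0)) `^ p)%R.
have [w [w0 wb Mw]] := orlicz_unbounded hb M.
have fw := orlicz_lt_b_fin (ltW w0) wb.
have Mw' : (M < fine (phi w))%R.
  by rewrite -lte_fin -(orlicz_fineK hphi (ltW w0) fw).
have u0w : (u0 <= w)%R.
  rewrite leNgt; apply/negP => wu.
  have : phi w <= phi u0 by apply: orlicz_mono => //; rewrite !ltW.
  rewrite (orlicz_fineK hphi (ltW w0) fw) (orlicz_fineK hphi (ltW u00) fu0).
  rewrite lee_fin leNgt => /negP; apply; apply: le_lt_trans Mw'.
  by rewrite le_max lexx.
have pw0 : 0 < phi w.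
  apply: lt_le_trans pu0 _; apply: orlicz_mono => //.
  by rewrite (ltW u00).
have [|K [q [K0 q01 hK]]] := @root_convex_dyadic_decay R phi p u0 w hphi p1
    (ltW u00) u0w orlicz_lt_b_fin (orlicz_fin_lt_b hb) u0b A B gamma A0 B0 cvx
    (fun u h1 h2 => hg u (conj h1 h2)); last by exists w, K, q; split.
move=> v wv vb.
have v0 : (0 < v)%R := lt_le_trans w0 wv.
have fv := orlicz_lt_b_fin (ltW v0) vb.
rewrite -(ler_pM2l B0) mulrCA.
have /andP[_] := hg v (conj (le_trans u0w wv) vb).
rewrite (orlicz_fineK hphi (ltW v0) fv) poweR_EFin lee_fin; apply: le_trans.
have [h|h] := leP (2 * (B * gamma u0))%R 0%R.
  by apply: le_trans h _; exact: powR_ge0.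
have -> : (2 * (B * gamma u0) =
    ((2 * (B * gamma u0)) `^ p) `^ p^-1)%R.
  by rewrite -powRrM mulfV ?lt0r_neq0// powRr1// ltW.
apply: ge0_ler_powR.
- by rewrite invr_ge0 ltW.
- by rewrite nnegrE powR_ge0.
- by rewrite nnegrE fine_orlicz_ge0// ltW.
apply: (@le_trans _ _ (fine (phi w))).
  by apply: le_trans (ltW Mw'); rewrite le_max lexx orbT.
rewrite -lee_fin -(orlicz_fineK hphi (ltW w0) fw).
rewrite -(orlicz_fineK hphi (ltW v0) fv); apply: orlicz_mono => //.
by rewrite (ltW w0).
Qed.

(** Here [gamma 0 = 0] is forced by [phi 0 = 0], so the threshold is 0. *)
Lemma root_all_dyadic_decay (p : R) : (1 < p)%R ->
  orlicz_at_b phi = +oo -> root_equiv_convex_all phi p ->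
  exists K q : R, [/\ (0 <= K)%R, (0 < q < 1)%R & dyadic_decay phi K q 0].
Proof.
move=> p1 hb [A [B [gamma [A0 B0 cvx hg]]]].
have p0 : (0 < p)%R by apply: lt_trans p1.
apply: (@root_convex_dyadic_decay R phi p 0 0 hphi p1 (lexx _) (lexx _)
  orlicz_lt_b_fin (orlicz_fin_lt_b hb) orlicz_b_gt0 A B gamma A0 B0 cvx
  (fun u h1 h2 => hg u (conj h1 h2))).
move=> v v0 vb.
have -> : gamma 0%R = 0%R.
  have := hg 0%R (conj (lexx _) orlicz_b_gt0).
  rewrite (orlicz_0 hphi) poweR_EFin powR0 ?invr_neq0 ?lt0r_neq0//.
  rewrite !lee_fin pmulr_rle0// pmulr_rge0// => /andP[g1 g2].
  by apply/le_anti; rewrite g1.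
rewrite mulr0 -(pmulr_rge0 _ B0).
have /andP[_] := hg v (conj v0 vb).
rewrite (orlicz_fineK hphi v0 (orlicz_lt_b_fin v0 vb)) poweR_EFin lee_fin.
by apply: le_trans; exact: powR_ge0.
Qed.

End finiteness_threshold.

(** * Failure of the doubling condition *)

Section doubling.
Context {R : realType} (phi : R -> \bar R) (hphi : orlicz_function phi).

Lemma bernoulli_le (e : R) n : (0 <= e)%R -> (n%:R * e <= (1 + e) ^+ n)%R.
Proof.
move=> e0; suff : (1 + n%:R * e <= (1 + e) ^+ n)%R.
  by apply: le_trans; rewrite lerDr.
elim: n => [|n IH]; first by rewrite mul0r addr0 expr0.
have n0 : (0 <= n%:R * e * e)%R by rewrite !mulr_ge0.
rewrite exprS; apply: (@le_trans _ _ ((1 + e) * (1 + n%:R * e)))%R.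
  by rewrite mulrS; lra.
by rewrite ler_pM2l// ltr_wpDr.
Qed.

Lemma expr_large (e M : R) : (0 < e)%R -> exists n, (M <= (1 + e) ^+ n)%R.
Proof.
move=> e0; exists (Num.bound (`|M| / e)).
apply: le_trans (bernoulli_le _ (ltW e0)).
rewrite -ler_pdivrMr//; apply: (@le_trans _ _ (`|M| / e)%R).
  by rewrite ler_pM2r ?invr_gt0// ler_norm.
by apply/ltW/archi_boundP; rewrite divr_ge0// ltW.
Qed.

Lemma orlicz_iter (P : R -> Prop) (e K : R) : (0 < e)%R -> (0 < K)%R ->
  (forall u, P u -> phi ((1 + e) * u)%R <= K%:E * phi u) ->
  forall n u, (forall i, (i < n)%N -> P ((1 + e) ^+ i * u)%R) ->
  phi ((1 + e) ^+ n * u)%R <= (K ^+ n)%:E * phi u.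
Proof.
move=> e0 K0 hP; elim=> [|n IH] u hu; first by rewrite !expr0 mul1r mul1e.
rewrite exprS -mulrA; apply: (le_trans (hP _ (hu n (ltnSn n)))).
rewrite exprS EFinM -muleA; apply: lee_wpmul2l; first by rewrite lee_fin ltW.
by apply: IH => i ni; apply: hu; rewrite ltnS ltnW.
Qed.

(** If [phi] grew at most by the factor [K] under every dilation by [1 + e]
    above [w], iterating the dilation until it exceeds 2 would first show
    that [phi] is finite everywhere and then give the doubling condition. *)
Lemma not_Delta2_infty (e K w : R) : ~ Delta2_infty phi ->
  (0 < e)%R -> (0 < K)%R -> (0 < w)%R -> phi w < +oo ->
  exists u, [/\ (w <= u)%R, phi u < +oo &
    K%:E * phi u < phi ((1 + e) * u)%R].
Proof.
move=> nD e0 K0 w0 wo; apply: contrapT => H; apply: nD.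
have e1 : (0 < 1 + e)%R by rewrite addr_gt0.
have step u : (w <= u)%R /\ phi u < +oo ->
    phi ((1 + e) * u)%R <= K%:E * phi u.
  move=> [wu uo]; rewrite leNgt; apply/negP => h; apply: H.
  by exists u.
have grow n u : (w <= u)%R -> phi u < +oo ->
    phi ((1 + e) ^+ n * u)%R <= (K ^+ n)%:E * phi u.
  move=> wu uo; have u0 : (0 < u)%R by apply: lt_le_trans wu.
  have fin i : (w <= (1 + e) ^+ i * u)%R /\ phi ((1 + e) ^+ i * u)%R < +oo.
    elim: i => [|i [wi io]]; first by rewrite expr0 mul1r.
    rewrite exprS -mulrA; split.
      apply: (le_trans wi).
      by rewrite ler_peMl ?lerDl ?ltW// mulr_gt0 ?exprn_gt0.
    apply: le_lt_trans (step _ (conj wi io)) _.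
    rewrite lte_mul_pinfty ?lee_fin ?(ltW K0)//.
  by apply: (orlicz_iter e0 K0 step) => i _; exact: fin.
have fin u : (0 <= u)%R -> phi u < +oo.
  move=> u0; have [n hn] := @expr_large e (u / w)%R e0.
  apply: (@le_lt_trans _ _ (phi ((1 + e) ^+ n * w)%R)).
    by apply: orlicz_mono => //; rewrite u0/= -ler_pdivrMr.
  apply: le_lt_trans (grow n w (lexx _) wo) _.
  by rewrite lte_mul_pinfty ?lee_fin ?exprn_ge0 ?(ltW K0).
have [m hm] := @expr_large e 2 e0.
exists (K ^+ m)%R, w; split => //; first by rewrite exprn_gt0.
move=> u wu; have u0 : (0 < u)%R by apply: lt_le_trans wu.
apply: le_trans (grow m u wu (fin u (ltW u0))).
by apply: orlicz_mono => //; rewrite mulr_ge0 ?(ltW u0)//= ler_pM2r.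
Qed.

(** The doubling condition holds near infinity and fails globally, so it fails
    near 0, and the points where it fails can be taken with both [phi u] and
    [phi u / u] small, the latter because [dyadic_decay] forces
    [phi u / u] to 0.  Otherwise dilations by [1 + e] are controlled on an
    interval [[0, v0]]; between this interval and [u0] the doubling condition
    follows from the positivity of [phi], which holds because a zero of [phi]
    would propagate under the dilations to all of the half line. *)
Lemma not_Delta2_Rplus (e K z k q : R) : ~ Delta2_Rplus phi ->
  Delta2_infty phi ->
  (0 < e)%R -> (0 < K)%R -> (0 < z)%R ->
  (0 <= k)%R -> (0 < q < 1)%R -> dyadic_decay phi k q 0 ->
  exists u, [/\ (0 < u)%R, phi u <= z%:E, phi u <= (z * u)%:E &
    K%:E * phi u < phi ((1 + e) * u)%R].
Proof.
move=> nD [K0 [u0 [K00 u00 u0o hK0]]] e0 Kgt0 z0 k0 /andP[q0 q1] hk.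
apply: contrapT => H.
have e1 : (0 < 1 + e)%R by rewrite addr_gt0.
have step u : [/\ (0 < u)%R, phi u <= z%:E & phi u <= (z * u)%:E] ->
    phi ((1 + e) * u)%R <= K%:E * phi u.
  move=> [ugt0 uz uzu]; rewrite leNgt; apply/negP => h; apply: H.
  by exists u.
have pos v : (0 < v)%R -> 0 < phi v.
  move=> v0; rewrite lt0e (orlicz_ge0 hphi) ?(ltW v0)// andbT.
  apply/eqP => pv0; have [u ugt0] := orlicz_not_identically_0 hphi.
  have [n hn] := @expr_large e (u / v)%R e0.
  have pn i : phi ((1 + e) ^+ i * v)%R = 0.
    elim: i => [|i IH]; first by rewrite expr0 mul1r.
    have vi : (0 < (1 + e) ^+ i * v)%R by rewrite mulr_gt0 ?exprn_gt0.
    apply/eqP; rewrite eq_le (orlicz_ge0 hphi) ?andbT; last first.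
      by rewrite mulr_ge0 ?exprn_ge0 ?(ltW e1) ?(ltW v0).
    rewrite exprS -mulrA.
    apply: le_trans (step _ _) _; last by rewrite IH mule0.
    by split=> //; rewrite IH lee_fin ?ltW// mulr_gt0.
  move=> /eqP; apply; apply/eqP.
  rewrite eq_le (orlicz_ge0 hphi) ?(ltW ugt0)// andbT.
  rewrite -(pn n); apply: orlicz_mono => //.
  by rewrite (ltW ugt0)/= -ler_pdivrMr.
have [v0 [v0gt0 v0z v0zv]] : exists v,
    [/\ (0 < v)%R, phi v <= z%:E & phi v <= (z * v)%:E].
  have [u1 u1gt0 u1o] := orlicz_fin_point hphi.
  pose P := fine (phi u1).
  have P0 : (0 <= P)%R := fine_orlicz_ge0 hphi (ltW u1gt0).
  have [j hj] : exists j, (k * P * q ^+ j <= z * Num.min 1 u1)%R.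
    have d0 : (0 < q^-1 - 1)%R by rewrite subr_gt0 invf_gt1.
    have zm : (0 < z * Num.min 1 u1)%R by rewrite mulr_gt0// lt_min ltr01.
    have [n hn] := @expr_large (q^-1 - 1)%R (k * P / (z * Num.min 1 u1))%R d0.
    exists n; move: hn; rewrite addrC subrK exprVn ler_pdivrMr//.
    by rewrite [leRHS]mulrC ler_pdivlMr ?exprn_gt0.
  have j0 : (0 < 2 ^+ j :> R)%R by rewrite exprn_gt0.
  have j1 : ((2 ^+ j)^-1 <= 1 :> R)%R by rewrite invf_le1// exprn_ege1// ler1n.
  have kPq : (0 <= k * P * q ^+ j)%R by rewrite !mulr_ge0// exprn_ge0// ltW.
  have hv : phi (u1 / 2 ^+ j)%R <= (k * P * q ^+ j * (2 ^+ j)^-1)%:E.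
    apply: le_trans (hk u1 j u1gt0 u1o _) _; first by rewrite divr_ge0// ltW.
    rewrite (orlicz_fineK hphi (ltW u1gt0) u1o) -EFinM lee_fin -/P.
    by rewrite exprMn exprVn le_eqVlt; apply/orP; left; apply/eqP; ring.
  exists (u1 / 2 ^+ j)%R; split; first by rewrite divr_gt0.
    apply: (le_trans hv); rewrite lee_fin.
    apply: (@le_trans _ _ (k * P * q ^+ j)%R).
      by rewrite ler_piMr.
    by apply: (le_trans hj); rewrite ler_piMr ?(ltW z0)// ge_min lexx.
  apply: (le_trans hv); rewrite lee_fin mulrA ler_pM2r ?invr_gt0//.
  by apply: (le_trans hj); rewrite ler_pM2l// ge_min lexx orbT.
have small u : (0 < u <= v0)%R ->
    [/\ (0 < u)%R, phi u <= z%:E & phi u <= (z * u)%:E].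
  move=> /andP[ugt0 uv]; split=> //.
    by apply: le_trans v0z; apply: orlicz_mono => //; rewrite (ltW ugt0).
  have := @orlicz_ratio R phi hphi u v0.
  rewrite (ltW ugt0) uv => /(_ isT v0gt0).
  move=> /le_trans; apply.
  apply: (@le_trans _ _ ((u / v0)%:E * (z * v0)%:E)).
    by apply: lee_wpmul2l => //; rewrite lee_fin divr_ge0// ltW.
  rewrite -EFinM lee_fin le_eqVlt; apply/orP; left; apply/eqP; field.
  exact: lt0r_neq0.
have [m hm] := @expr_large e 2 e0.
pose v1 := (v0 / (1 + e) ^+ m)%R.
have v1gt0 : (0 < v1)%R by rewrite divr_gt0// exprn_gt0.
have p1 := pos v1 v1gt0.
have u0oo : phi (2 * u0)%R < +oo.
  apply: le_lt_trans (hK0 u0 (lexx _)) _.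
  by rewrite lte_mul_pinfty ?lee_fin ?(ltW K00).
have u2gt0 : (0 <= 2 * u0)%R by rewrite mulr_ge0// ltW.
pose Q := fine (phi (2 * u0)%R).
have Q0 : (0 <= Q)%R by apply: fine_orlicz_ge0.
have [P1 P1gt0 P1le] : exists2 r : R, (0 < r)%R & r%:E <= phi v1.
  case: (phi v1) p1 => [r||]//; last by exists 1%R => //; rewrite leey.
  by rewrite lte_fin => r0; exists r.
have Km0 : (0 < K ^+ m)%R by rewrite exprn_gt0.
have QP0 : (0 <= Q / P1)%R by rewrite divr_ge0// ltW.
apply: nD; exists (K ^+ m + Q / P1 + K0)%R.
  by rewrite ltr_wpDl// addr_ge0// ltW.
move=> u u_ge0; have [u_le0|u_gt0] := leP u 0%R.
  have -> : u = 0%R by apply/le_anti; rewrite u_ge0 u_le0.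
  by rewrite mulr0 (orlicz_0 hphi) mule0.
have pu := orlicz_ge0 hphi u_ge0.
have weak c : (c <= K ^+ m + Q / P1 + K0)%R -> phi (2 * u)%R <= c%:E * phi u ->
    phi (2 * u)%R <= (K ^+ m + Q / P1 + K0)%:E * phi u.
  move=> hc h; apply: (le_trans h).
  by apply: lee_wpmul2r => //; rewrite lee_fin.
have [uu0|u0u] := leP u0 u.
  by apply: (weak K0); [rewrite lerDr addr_ge0// ltW|exact: hK0].
have [uv1|v1u] := leP u v1.
  apply: (weak (K ^+ m)%R); first by rewrite -addrA lerDl addr_ge0// ltW.
  apply: (@le_trans _ _ (phi ((1 + e) ^+ m * u)%R)).
    by apply: orlicz_mono => //; rewrite mulr_ge0//= ler_pM2r.
  apply: (orlicz_iter e0 Kgt0 step) => i im; apply: small.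
  rewrite mulr_gt0 ?exprn_gt0//=.
  apply: (@le_trans _ _ ((1 + e) ^+ m * u)%R).
    by rewrite ler_pM2r// ler_weXn2l ?lerDl ?(ltW e0)// ltnW.
  by rewrite mulrC -ler_pdivlMr ?exprn_gt0.
apply: (weak (Q / P1)%R).
  by rewrite addrAC lerDr addr_ge0// ltW.
apply: (@le_trans _ _ (phi (2 * u0)%R)).
  by apply: orlicz_mono => //; rewrite mulr_ge0//= ler_pM2l// ltW.
apply: (@le_trans _ _ ((Q / P1)%:E * P1%:E)).
  by rewrite -EFinM divfK ?lt0r_neq0// -orlicz_fineK.
apply: lee_wpmul2l; first by rewrite lee_fin.
apply: (le_trans P1le); apply: orlicz_mono => //.
by rewrite (ltW v1gt0) ltW.
Qed.

End doubling.

(** * Existence of good blocks *)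

Section supplies.
Context {R : realType} (phi : R -> \bar R) (hphi : orlicz_function phi).
Local Notation LR := (lebesgueTypeR R).

Lemma ae_zero_of_integrals (g : R -> R) : L0 half_line g ->
  (forall n : nat,
    \int[leb_mu]_(t in (`[0%R, n.+1%:R] : set LR)) `|g t|%:E = 0) ->
  eq_ae half_line g (fun=> 0%R).
Proof.
move=> mg g0.
have /ae_foralln : forall n : nat, {ae leb_mu, forall t : LR,
    `[0%R, n.+1%:R]%classic t -> (g t)%:E = 0}.
  move=> n.
  have mD : measurable (`[0%R, n.+1%:R] : set LR) := measurable_Lebesgue_itv _.
  have mgn : measurable_fun (`[0%R, n.+1%:R] : set LR) (fun t : LR => (g t)%:E).
    apply/measurable_EFinP.
    apply: (measurable_funS (measurable_base_set half_line) _ mg).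
    by move=> t; rewrite /= !in_itv/= andbT => /andP[].
  by apply/(ae_eq_integral_abs leb_mu mD mgn).1/g0.
apply: filterS => t tg; rewrite /= in_itv/= andbT => t0.
suff Dt : `[0%R, (Num.bound t).+1%:R]%classic t by case: (tg _ Dt).
rewrite /= in_itv/= t0 ltW// (lt_trans (archi_boundP t0))//.
by rewrite ltr_nat.
Qed.

(** On the half line, a nonzero element of the space has Cesaro mean at least
    [a / x] for large [x] and some [a > 0], so [phi (a / x)] is integrable
    at infinity.  On the unit interval every height at which [phi] is
    finite will do. *)
Lemma finite_block_modular (I : base_interval) :
  (exists2 f : R -> R, Ces I phi f & ~ eq_ae I f (fun=> 0%R)) ->
  exists u c : R, [/\ (0 < u)%R, (0 < c)%R & block_modular phi I u c < +oo].
Proof.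
have [v v0 vo] := orlicz_fin_point hphi.
have mI := measurable_base_set (R := R) I.
case: I mI => mI [f [mf [l l0 fl]] fn0].
  exists v, 1%R; split => //.
  apply: (@le_lt_trans _ _ (\int[leb_mu]_(x in (`[0%R, 1%R] : set LR))
      cst (phi v) x)).
    apply: ge0_le_integral_any => x _.
      by apply: (orlicz_block_mean_ge0 hphi) => //; exact: ltW.
    apply: orlicz_mono => //.
    by rewrite block_mean_ge0 ?block_mean_le ?(ltW v0).
  rewrite integral_cst_itv /= lte_fin ltr01 -EFinB subr0 mule1.
  exact: vo.
pose g t := (f t / l)%R.
have [n gn] : exists n : nat,
    \int[leb_mu]_(t in (`[0%R, n.+1%:R] : set LR)) `|g t|%:E <> 0.
  apply: contrapT => H; apply: fn0.
  have mg : L0 half_line g.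
    by apply: measurable_funM; [exact: mf|exact: measurable_cst].
  have : eq_ae half_line g (fun=> 0%R).
    apply: ae_zero_of_integrals => // n.
    by apply: contrapT => h; apply: H; exists n.
  apply: filterS => t ht It; have /eqP := ht It.
  by rewrite /g mulf_eq0 invr_eq0 (negbTE (lt0r_neq0 l0)) orbF => /eqP.
set S := integral _ _ _ in gn.
have [a a0 aS] : exists2 a : R, (0 < a)%R & a%:E <= S.
  have : 0 < S.
    by rewrite lt0e; apply/andP; split; [exact/eqP|apply: integral_ge0].
  case: S gn => [r||]// _; last by exists 1%R => //; rewrite leey.
  by rewrite lte_fin => r0; exists r.
pose x0 : R := n.+1%:R; have x00 : (0 < x0)%R by rewrite ltr0n.
pose c := Num.min a (v * x0)%R.
have c0 : (0 < c)%R by rewrite lt_min a0 mulr_gt0.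
pose u := (c / x0)%R; have u0 : (0 < u)%R by rewrite divr_gt0.
have uv : (u <= v)%R by rewrite ler_pdivrMr// ge_min lexx orbT.
have uo : phi u < +oo.
  by apply: le_lt_trans vo; apply: orlicz_mono => //; rewrite (ltW u0).
pose W := fine (phi u); have W0 : (0 <= W)%R := fine_orlicz_ge0 hphi (ltW u0).
exists u, c; split => //.
have p0 x : 0 <= phi (block_mean u c x).
  by apply: (orlicz_block_mean_ge0 hphi); exact: ltW.
pose E : set LR := `]x0, +oo[%classic.
have mE : measurable E := measurable_Lebesgue_itv _.
pose g1 (x : LR) : \bar R :=
  W%:E * (\1_(`[0%R, (x0 + 1)%R[%classic : set LR) x)%:E.
pose g2 (x : LR) : \bar R := phi (block_mean u c x) * (\1_E x)%:E.
have g10 x : 0 <= g1 x by rewrite mule_ge0// lee_fin.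
have g20 x : 0 <= g2 x by rewrite mule_ge0// lee_fin.
have mg1 : measurable_fun (base_set half_line : set LR) g1.
  exact: measurable_scaled_indic.
have mg2 : measurable_fun (base_set half_line : set LR) g2.
  apply: emeasurable_funM.
    by apply: measurable_orlicz_block_mean => //; exact: ltW.
  by apply/measurable_EFinP; apply: measurable_indic; exact: mE.
apply: (@le_lt_trans _ _
    (\int[leb_mu]_(x in (base_set half_line : set LR)) (g1 x + g2 x))).
  apply: ge0_le_integral_any => x Ix; first exact: p0.
  have x_ge0 := base_set_ge0 Ix.
  have [xx0|x0x] := leP x x0.
    rewrite -[leLHS]adde0; apply: leeD; last exact: g20.
    rewrite /g1 indicE mem_set /= ?in_itv/= ?x_ge0 ?(le_lt_trans xx0) ?ltrDl//.
    rewrite mule1 -orlicz_fineK ?(ltW u0)//.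
    by apply: orlicz_mono => //; rewrite block_mean_le block_mean_ge0// ltW.
  rewrite -[leLHS]add0e; apply: leeD; first exact: g10.
  by rewrite /g2 indicE mem_set /E/= ?in_itv/= ?x0x// mule1.
rewrite (ge0_integralD leb_mu mI (fun x _ => g10 x) mg1 (fun x _ => g20 x) mg2).
apply: lte_add_pinfty.
  have x1 : (0 <= x0 + 1)%R by rewrite addr_ge0// ltW.
  by apply: le_lt_trans (integral_scaled_indic_le half_line W0 x1) (ltry _).
apply: le_lt_trans fl; apply: ge0_le_integral_any => x Ix; first exact: g20.
have x_ge0 := base_set_ge0 Ix.
have [xx0|x0x] := leP x x0.
  rewrite /g2 indicE memNset ?mule0; first exact: orlicz_ext_ge0.
  by rewrite /E /= in_itv/= andbT => h; have := lt_le_trans h xx0; rewrite ltxx.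
rewrite /g2 indicE mem_set /E/= ?in_itv/= ?x0x// mule1.
have {}x_ge0 : (0 < x)%R := lt_trans x00 x0x.
have C0 : 0 <= cesaro_op (fun t => `|(f t / l)%R|%:E) x.
  by apply: cesaro_op_ge0 => [|s]; rewrite ?lee_fin// ltW.
apply: (@orlicz_ext_mono _ _ hphi (block_mean u c x)%:E).
  by rewrite lee_fin block_mean_ge0// ltW.
rewrite gee0_abs//.
apply: (@le_trans _ _ ((x^-1)%:E * a%:E)).
  rewrite -EFinM lee_fin mulrC; apply: (le_trans (block_mean_div _ _ x_ge0)).
  by rewrite ler_pM2r ?invr_gt0// ge_min lexx.
apply: lee_wpmul2l; first by rewrite lee_fin invr_ge0 ltW.
apply: (le_trans aS); apply: ge0_le_set_integral_any => [t _|t _|t /=|t _].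
- by rewrite lee_fin.
- by rewrite lee_fin.
- by rewrite !in_itv/= => /andP[-> tx]; rewrite (le_trans tx)// ltW.
- by [].
Qed.

Lemma gt_mul_of_ratio (t P : R) (Y : \bar R) : (0 < t)%R ->
  (4 <= t * P)%R -> P%:E < Y -> 3 < t%:E * Y.
Proof.
move=> t0 tP PY; apply: (@lt_le_trans _ _ (t%:E * P%:E)).
  by rewrite -EFinM lte_fin; lra.
by apply: lee_wpmul2l; [rewrite lee_fin ltW|exact: ltW].
Qed.

(** When [phi] jumps from a finite value at [b] to infinity, a short block of
    height [b] has a small modular, and an infinite one after any
    dilation. *)
Lemma small_blocks_jump (I : base_interval) (b u1 c1 : R) :
  (0 < u1)%R -> (0 < c1)%R -> block_modular phi I u1 c1 < +oo ->
  (0 < b)%R -> orlicz_b phi = b%:E -> phi b < +oo ->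
  forall e d : R, (0 < e)%R -> (0 < d)%R -> exists u t : R,
    [/\ good_block I phi e u t, (t <= d)%R & (u * t <= d)%R].
Proof.
move=> u10 c10 fin b0 Eb bo e d e0 d0.
have [d1 d10 hd1] := block_modular_small hphi u10 c10 fin (ltW b0) bo e0.
pose t := Num.min d (Num.min d d1 / b)%R.
have t0 : (0 < t)%R by rewrite lt_min d0 divr_gt0// lt_min d0.
have bt : (b * t <= Num.min d d1)%R.
  by rewrite mulrC -ler_pdivlMr// ge_min lexx orbT.
exists b, t; split.
- split => //.
    apply: hd1; rewrite mulr_ge0 ?(ltW b0) ?(ltW t0)//=.
    by apply: (le_trans bt); rewrite ge_min lexx orbT.
  suff -> : phi ((1 + e) * b)%R = +oo by rewrite gt0_muley ?lte_fin// ltey.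
  apply/eqP; rewrite eq_le leey/= leNgt; apply/negP => /orlicz_fin_le_b.
  rewrite Eb lee_fin mulr_gt0 ?addr_gt0// => /(_ isT).
  by rewrite leNgt ltr_pMl// ltrDl e0.
- by rewrite ge_min lexx.
- by apply: (le_trans bt); rewrite ge_min lexx.
Qed.

(** The height [u] is a point where the doubling condition fails and
    [t = s / phi u].  The mass [u * t] is then at most [s * w / phi w] because
    [phi u / u] is nondecreasing; hence [s] can be fixed beforehand, small
    enough for all requirements, and [u] chosen afterwards with the ratio of
    [phi ((1 + e) * u)] to [phi u] above [4 / s]. *)
Lemma small_blocks_Delta2 (I : base_interval) (w K q u1 c1 : R) :
  (0 < u1)%R -> (0 < c1)%R -> block_modular phi I u1 c1 < +oo ->
  ~ Delta2_infty phi ->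
  (0 < w)%R -> phi w < +oo -> 0 < phi w -> (0 <= K)%R -> (0 < q < 1)%R ->
  dyadic_decay phi K q w ->
  forall e d : R, (0 < e)%R -> (0 < d)%R -> exists u t : R,
    [/\ good_block I phi e u t, (t <= d)%R & (u * t <= d)%R].
Proof.
move=> u10 c10 fin nD w0 wo pw K0 q01 hK e d e0 d0.
have e20 : (0 < e / 2)%R by rewrite divr_gt0.
have [d1 d10 hd1] := block_modular_small hphi u10 c10 fin (ltW w0) wo e20.
have q1 : (0 < 1 - q)%R by rewrite subr_gt0; case/andP: q01.
pose C := (2 * K / (1 - q))%R.
have C0 : (0 <= C)%R by rewrite divr_ge0 ?mulr_ge0// ltW.
pose W := fine (phi w); have WE := orlicz_fineK hphi (ltW w0) wo.
have W0 : (0 < W)%R by rewrite -lte_fin -WE.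
pose s := Num.min (e / (2 * (C + 1)))%R
  (Num.min (d * W) (Num.min d d1 * W / w))%R.
have s0 : (0 < s)%R.
  rewrite !lt_min !divr_gt0 ?mulr_gt0 ?lt_min ?d0 ?d10//.
  by rewrite ltr_wpDl.
have se : (C * s <= e / 2)%R.
  apply: (@le_trans _ _ (C * (e / (2 * (C + 1)))))%R.
    by rewrite ler_wpM2l// ge_min lexx.
  rewrite mulrA ler_pdivrMr; first lra.
  by rewrite mulr_gt0// ltr_wpDl.
have k0 : (0 < 4 / s)%R by rewrite divr_gt0.
have [u [wu uo hu]] := not_Delta2_infty hphi nD e0 k0 w0 wo.
have u0 : (0 < u)%R := lt_le_trans w0 wu.
pose P := fine (phi u); have PE := orlicz_fineK hphi (ltW u0) uo.
have WP : (W <= P)%R.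
  by rewrite -lee_fin -WE -PE; apply: orlicz_mono => //; rewrite (ltW w0).
have P0 : (0 < P)%R := lt_le_trans W0 WP.
have uP : (u * W <= w * P)%R.
  have := @orlicz_ratio R phi hphi w u; rewrite (ltW w0) wu => /(_ isT u0).
  rewrite WE PE -EFinM lee_fin -/W -/P mulrAC ler_pdivlMr//.
  by rewrite mulrC.
pose t := (s / P)%R; have t0 : (0 < t)%R by rewrite divr_gt0.
have utd : (u * t <= Num.min d d1)%R.
  rewrite /t mulrA ler_pdivrMr//.
  have : (s <= Num.min d d1 * W / w)%R by rewrite !ge_min lexx !orbT.
  rewrite ler_pdivlMr// => sw.
  have m0 : (0 < Num.min d d1)%R by rewrite lt_min d0.
  rewrite -(ler_pM2r w0) -mulrA.
  apply: (@le_trans _ _ (u * (Num.min d d1 * W)))%R.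
    by rewrite ler_pM2l.
  by rewrite mulrCA -mulrA ler_pM2l// [leRHS]mulrC.
exists u, t; split.
- split=> //.
    apply: le_trans
      (block_modular_dyadic hphi I K0 q01 (ltW w0) hK u0 t0 uo wu) _.
    rewrite (splitr e) EFinD; apply: leeD.
      by rewrite lee_fin -/C -/P /t -mulrA divfK ?lt0r_neq0.
    apply: hd1; rewrite mulr_ge0 ?(ltW u0) ?(ltW t0)//=.
    by apply: (le_trans utd); rewrite ge_min lexx orbT.
  apply: (gt_mul_of_ratio t0 _ (P := (4 / s * P)%R)); last first.
    by rewrite EFinM -PE.
  by rewrite le_eqVlt /t; apply/orP; left; apply/eqP; field; rewrite !lt0r_neq0.
- have sd : (s <= d * W)%R by rewrite !ge_min lexx !orbT.
  rewrite /t ler_pdivrMr//; apply: (le_trans sd).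
  by rewrite ler_pM2l.
- by apply: (le_trans utd); rewrite ge_min lexx.
Qed.

Lemma block_modular0 (I : base_interval) (c : R) : (0 <= c)%R ->
  block_modular phi I 0 c = 0.
Proof.
move=> c0; apply: integral0_eq => x _.
have -> : block_mean 0 c x = 0%R; last exact: orlicz_0.
by apply/le_anti; rewrite block_mean_le block_mean_ge0.
Qed.

(** Again [t = s / phi u], now with [phi u] and [phi u / u] at most [s / d], so
    that both the length and the mass of the block exceed [d].  If
    [phi u = 0], the block has zero modular and may be taken as long as
    wanted. *)
Lemma large_blocks_Delta2 (K q : R) :
  ~ Delta2_Rplus phi -> Delta2_infty phi ->
  (0 <= K)%R -> (0 < q < 1)%R -> dyadic_decay phi K q 0 ->
  forall e d : R, (0 < e)%R -> (0 < d)%R -> exists u t : R,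
    [/\ good_block half_line phi e u t, (d <= t)%R & (d <= u * t)%R].
Proof.
move=> nD D K0 q01 hK e d e0 d0.
have q1 : (0 < 1 - q)%R by rewrite subr_gt0; case/andP: q01.
pose C := (2 * K / (1 - q))%R.
have C0 : (0 <= C)%R by rewrite divr_ge0 ?mulr_ge0// ltW.
pose s := (e / (C + 1))%R.
have s0 : (0 < s)%R by rewrite divr_gt0// ltr_wpDl.
have se : (C * s <= e)%R.
  rewrite mulrA ler_pdivrMr; first lra.
  by rewrite ltr_wpDl.
have k0 : (0 < 4 / s)%R by rewrite divr_gt0.
have z0 : (0 < s / d)%R by rewrite divr_gt0.
have [u [u0 uz uzu hu]] := not_Delta2_Rplus hphi nD D e0 k0 z0 K0 q01 hK.
have uo : phi u < +oo by apply: le_lt_trans uz (ltry _).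
pose P := fine (phi u); have PE := orlicz_fineK hphi (ltW u0) uo.
have P0 : (0 <= P)%R := fine_orlicz_ge0 hphi (ltW u0).
suff [t [t0 dt dut CtP tY]] : exists t, [/\ (0 < t)%R, (d <= t)%R,
    (d <= u * t)%R, (C * (t * P) <= e)%R & 3 < t%:E * phi ((1 + e) * u)%R].
  exists u, t; split=> //; split=> //.
  apply: le_trans
    (block_modular_dyadic hphi _ K0 q01 (lexx _) hK u0 t0 uo (ltW u0)) _.
  rewrite block_modular0 ?mulr_ge0 ?(ltW u0) ?(ltW t0)// adde0 lee_fin -/C -/P.
  by rewrite -mulrA.
move: uz uzu hu; rewrite PE -/P !lee_fin => uz uzu hu.
have [P_gt0|P_le0] := ltP 0%R P.
  exists (s / P)%R; split.
  - by rewrite divr_gt0.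
  - by rewrite ler_pdivlMr// mulrC -ler_pdivlMr.
  - rewrite mulrA ler_pdivlMr// mulrC -ler_pdivlMr//.
    by rewrite mulrC mulrA in uzu *.
  - by rewrite divfK ?lt0r_neq0.
  apply: (gt_mul_of_ratio _ _ (P := (4 / s * P)%R)); first by rewrite divr_gt0.
    by rewrite le_eqVlt; apply/orP; left; apply/eqP; field; rewrite !lt0r_neq0.
  by rewrite EFinM.
have P00 : P = 0%R by apply/le_anti; rewrite P_le0.
have [r r0 rY] : exists2 r : R, (0 < r)%R & r%:E < phi ((1 + e) * u)%R.
  move: hu; rewrite P00 mule0; case: (phi _) => [y||]//; last first.
    by exists 1%R; rewrite ?ltry.
  by rewrite lte_fin => y0; exists (y / 2)%R; rewrite ?lte_fin; lra.
pose t := Num.max d (Num.max (d / u) (4 / r))%R.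
have t0 : (0 < t)%R by rewrite lt_max d0.
exists t; split=> //.
- by rewrite le_max lexx.
- by rewrite mulrC -ler_pdivrMr// !le_max lexx !orbT.
- by rewrite P00 !mulr0 ltW.
- apply: (gt_mul_of_ratio t0 _ rY).
  by rewrite -ler_pdivrMr// !le_max lexx !orbT.
Qed.

End supplies.

Theorem corollary13 (R : realType) (I : base_interval) (phi : R -> \bar R)
  (phi_orlicz : orlicz_function phi)
  (phi_ab : orlicz_b phi < +oo -> orlicz_a phi < orlicz_b phi)
  (Ces_neq0 : exists2 f : R -> R, Ces I phi f & ~ eq_ae I f (fun=> 0%R))
  (phi_root : orlicz_at_b phi = +oo ->
     exists2 p : R, (1 < p)%R & root_equiv_convex I phi p)
  (phi_nDelta2 : ~ Delta2 I phi) :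
  contains_order_isometric_copy_of_linfty I (Ces I phi) (Ces_norm I phi).
Proof.
have [u1 [c1 [u10 c10 fin]]] := finite_block_modular phi_orlicz Ces_neq0.
have [hb|/eqP hb] := eqVneq (orlicz_at_b phi) +oo; last first.
  have [b [b0 Eb bo]] := orlicz_at_b_fin phi_orlicz (introN eqP hb).
  apply: small_blocks_copy => //.
  exact: small_blocks_jump u10 c10 fin b0 Eb bo.
have [p p1 root] := phi_root hb.
have [D|nD] := pselect (Delta2_infty phi); last first.
  have large : root_equiv_convex_large phi p.
    by case: (I) root => //; exact: root_all_large.
  have [w [K [q [w0 wo pw [K0 q01] hK]]]] :=
    root_large_dyadic_decay phi_orlicz p1 hb large.
  apply: small_blocks_copy => //.
  exact: small_blocks_Delta2 u10 c10 fin nD w0 wo pw K0 q01 hK.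
case: I phi_nDelta2 root {Ces_neq0 phi_root fin} => // nD root.
have [K [q [K0 q01 hK]]] := root_all_dyadic_decay phi_orlicz p1 hb root.
apply: large_blocks_copy => //.
exact: large_blocks_Delta2 nD D K0 q01 hK.
Qed.
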